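(* Let $\mathfrak{g}$ be the simple Lie algebra of type $A_n$ over $\mathbb{C}$ with $n\ge2$, let $\sigma$ be the non-trivial automorphism $i\mapsto n+1-i$ of its Dynkin diagram, and let $\lambda=\Lambda_m$ with $1\le m\le (n+1)/2$, so that $P_\lambda=Y_{m,n-m+1}$. Let $\tilde{\mathcal{F}}(Y_{m,n-m+1})$ and $\mathcal{SS}(Y_{m,n-m+1})$ be the subsets of $\mathcal{F}(Y_{m,n-m+1})$ defined in the context. Then $$\tilde{\mathcal{F}}(Y_{m,n-m+1})=\mathcal{SS}(Y_{m,n-m+1}).$$
   Context: **The poset.** $Y_{m,n-m+1}=\{(i,j)\in\mathbb{Z}^2\mid 1\le i\le m,\ 1\le j\le n-m+1\}$ with $(i_1,j_1)\le(i_2,j_2)$ iff $i_1\ge i_2$ and $j_1\ge j_2$. $\mathcal{F}(Y_{m,n-m+1})$ is the set of order filters (up-closed subsets). The coloring is $\kappa:Y_{m,n-m+1}\to I=\{1,\dots,n\}$, $\kappa(i,j)=j-i+m$. **Lie algebra notation.** $I=\{1,\dots,n\}$ indexes the type $A_n$ Dynkin diagram linearly; $h_i$, $\alpha_i$, $\Lambda_i$ are the simple coroots, simple roots and fundamental weights; $\mathfrak h$ is the Cartan subalgebra; $W=\langle s_i\mid i\in I\rangle$ is the Weyl group, $s_i(\mu)=\mu-\mu(h_i)\alpha_i$. For $\mu,\mu'\in W\lambda$, $\mu\le_s\mu'$ iff there are $\mu=\mu_0,\dots,\mu_k=\mu'$ in $W\lambda$ and positive roots $\beta_0,\dots,\beta_{k-1}$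 with $s_{\beta_i}(\mu_i)=\mu_{i+1}$ and $\mu_i(\beta_i^\vee)>0$ for all $i$, where $s_\beta$ and $\beta^\vee$ denote the reflection and coroot of $\beta$. Let $f:(W\lambda,\le_s)\to(\mathcal{F}(Y_{m,n-m+1}),\subseteq)$ be the (known to exist) unique order isomorphism such that for $\mu\in W\lambda$, $i\in I$, $s_i\mu$ covers $\mu$ in $W\lambda$ iff $f(s_i\mu)\setminus f(\mu)$ consists of one element, of color $i$. **Folding.** $\sigma$ acts on $\mathfrak h$ by $h_i\mapsto h_{\sigma(i)}$ and on $\mathfrak{h}^*$ by $(\sigma\mu)(h)=\mu(\sigma^{-1}(h))$. $\hat W=\{w\in W\mid\sigma w\sigma^{-1}=w\}$. $\mathfrak{h}(0)=\{h\in\mathfrak{h}\mid\sigma(h)=h\}$ is a Cartan subalgebra of the fixed-point subalgebra $\mathfrak{g}(0)$ of the Lie algebra automorphism induced by $\sigma$, $\tilde W$ is the Weyl group of $\mathfrak g(0)$, and $\mathrm{res}:\mathfrak{h}^*\to\mathfrak{h}(0)^*$ is restriction; it restricts to a bijection $\hat W\lambda\to\tilde W\,\mathrm{res}(\lambda)$. Define $\tilde f:\tilde W\,\mathrm{res}(\lambda)\to\mathcal{F}(Y_{m,n-m+1})$ by $\tilde f(\mathrm{res}(\mu))=f(\mu)$ for $\mu\in\hat W\lambda$, and $\tilde{\mathcal{F}}(Y_{m,n-m+1})=\mathrm{Im}(\tilde f)$ (equivalently $f(\hat W\lambda)$). **The set $\mathcal{SS}$.** For $Y\in\mathcal{F}(Y_{m,n-m+1})$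 and $1\le l\le m$ put $\boldsymbol{k}_l=\#\{j\mid(l,j)\in Y\}$, $\mathcal{I}(Y)=\{\boldsymbol{k}_i+m+1-i\mid 1\le i\le m\}\subseteq\{1,\dots,n+1\}$ and $\overline{\mathcal{I}(Y)}=\{n+2-i\mid i\in\mathcal{I}(Y)\}$. Then $\mathcal{SS}(Y_{m,n-m+1})=\{Y\in\mathcal{F}(Y_{m,n-m+1})\mid\mathcal{I}(Y)\cap\overline{\mathcal{I}(Y)}=\emptyset\}$. *)

(* Defs.v *)
(* Mathematical Components, with the sets of mathcomp.classical.
   All indices are 0-based: the node i.+1 of the Dynkin diagram A_n is
   i : 'I_n, and the point (i.+1, j.+1) of Y_{m,n-m+1} is
   (i, j) : 'I_m * 'I_(n - m).+1. *)
From HB Require Import structures.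
From mathcomp Require Import all_boot all_order all_algebra.
From mathcomp Require Import classical_sets functions.

Set Implicit Arguments.
Unset Strict Implicit.
Unset Printing Implicit Defensive.

Import Order.TTheory GRing.Theory Num.Theory.
Local Open Scope ring_scope.
Local Open Scope classical_set_scope.

Notation dual C V := 'Hom(V, (C)^o).

(** * Reflections, generated groups, orbits *)

Definition reflection (C : fieldType) (V : vectType C)
  (beta : dual C V) (b : V) (mu : dual C V) : dual C V :=
  mu - (mu b : C) *: beta.

(* The submonoid generated by S. It is only used for sets S of reflections;
   these are involutions, so it is then the subgroup generated by S. *)
Inductive generated (T : Type) (S : set (T -> T)) : set (T -> T) :=
| generated_id : generated S id
| generated_comp s w : S s -> generated S w -> generated S (s \o w).

Definition orbit_of (T : Type) (G : set (T -> T)) (x : T) : set T :=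
  [set w x | w in G].

(** * Roots and coroots of a Lie algebra of matrices

   L is a Lie algebra of N x N matrices, and iota : V -> 'M_N is an
   injective linear map whose image is a Cartan subalgebra of L, so that V is
   identified with this Cartan subalgebra. *)

Definition bracket (C : fieldType) (N : nat) (x y : 'M[C]_N) : 'M[C]_N :=
  x *m y - y *m x.

Definition root_space (C : fieldType) (N : nat) (L : set 'M[C]_N)
  (V : vectType C) (iota : V -> 'M[C]_N) (beta : dual C V) : set 'M[C]_N :=
  [set x | L x /\ forall h, bracket (iota h) x = (beta h : C) *: x].

Definition is_root (C : fieldType) (N : nat) (L : set 'M[C]_N)
  (V : vectType C) (iota : V -> 'M[C]_N) (beta : dual C V) : Prop :=
  beta != 0 /\ exists2 x, root_space L iota beta x & x != 0.

(* The coroot of beta is the element b of [L_beta, L_{-beta}] such that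
   beta(b) = 2. Root spaces are one-dimensional when L is semisimple, so every
   element of [L_beta, L_{-beta}] is a single bracket. *)
Definition is_coroot (C : fieldType) (N : nat) (L : set 'M[C]_N)
  (V : vectType C) (iota : V -> 'M[C]_N) (beta : dual C V) (b : V) : Prop :=
  (exists x y, [/\ root_space L iota beta x, root_space L iota (- beta) y
                 & bracket x y = iota b])
  /\ beta b = 2%:R.

Definition weyl_group (C : fieldType) (N : nat) (L : set 'M[C]_N)
  (V : vectType C) (iota : V -> 'M[C]_N) : set (dual C V -> dual C V) :=
  generated [set r | exists beta b,
    [/\ is_root L iota beta, is_coroot L iota beta b
      & r = reflection beta b]].

(** * Type A_n

   The Cartan subalgebra is 'rV[C]_n, in the basis of the simple coroots. *)

Definition simple_coroot (C : fieldType) (n : nat) (i : 'I_n) : 'rV[C]_n :=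
  delta_mx 0 i.

Definition coroot_coord (C : fieldType) (n : nat) (i : 'I_n)
  (h : 'rV[C]_n) : C^o := h 0 i.

Fact coroot_coord_is_linear (C : fieldType) n i :
  linear (@coroot_coord C n i).
Proof. by move=> a u v; rewrite /coroot_coord !mxE. Qed.

HB.instance Definition _ (C : fieldType) n i :=
  GRing.isLinear.Build C 'rV[C]_n C^o *:%R (@coroot_coord C n i)
    (@coroot_coord_is_linear C n i).

Definition fundamental_weight (C : fieldType) (n : nat) (i : 'I_n) :
  dual C 'rV[C]_n := linfun (coroot_coord i).

Definition cartan_entry (n : nat) (i j : 'I_n) : int :=
  if i == j then 2 else if (i.+1 == j) || (j.+1 == i) then -1 else 0.

Definition simple_root (C : fieldType) (n : nat) (j : 'I_n) :
  dual C 'rV[C]_n :=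
  \sum_(i < n) (cartan_entry i j)%:~R *: fundamental_weight C i.

Definition simple_reflection (C : fieldType) (n : nat) (i : 'I_n) :
  dual C 'rV[C]_n -> dual C 'rV[C]_n :=
  reflection (simple_root C i) (simple_coroot C i).

Definition weyl_A (C : fieldType) (n : nat) :
  set (dual C 'rV[C]_n -> dual C 'rV[C]_n) :=
  generated [set r | exists i : 'I_n, r = simple_reflection i].

Lemma fundamental_weightE (C : fieldType) n (i j : 'I_n) :
  fundamental_weight C i (simple_coroot C j) = (i == j)%:R.
Proof. by rewrite lfunE /= /coroot_coord mxE eqxx. Qed.

Lemma simple_rootE (C : fieldType) n (i j : 'I_n) :
  simple_root C j (simple_coroot C i) = (cartan_entry i j)%:~R.
Proof.
rewrite sum_lfunE (bigD1 i) //= big1 => [|k ki].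
  by rewrite scale_lfunE fundamental_weightE eqxx addr0 [_ *: _]mulr1.
by rewrite scale_lfunE fundamental_weightE (negPf ki) scaler0.
Qed.

(** ** The realisation of the Lie algebra as sl_{n+1} *)

Definition sl (C : fieldType) (n : nat) : set 'M[C]_n.+1 :=
  [set x | \tr x = 0].

Definition ord_lo (n : nat) (i : 'I_n) : 'I_n.+1 := widen_ord (leqnSn n) i.
Definition ord_hi (n : nat) (i : 'I_n) : 'I_n.+1 := lift ord0 i.

Definition chevalley_e (C : fieldType) (n : nat) (i : 'I_n) : 'M[C]_n.+1 :=
  delta_mx (ord_lo i) (ord_hi i).
Definition chevalley_f (C : fieldType) (n : nat) (i : 'I_n) : 'M[C]_n.+1 :=
  delta_mx (ord_hi i) (ord_lo i).

Definition cartan_emb (C : fieldType) (n : nat) (h : 'rV[C]_n) :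
  'M[C]_n.+1 :=
  \sum_(i < n) h 0 i *:
    (delta_mx (ord_lo i) (ord_lo i) - delta_mx (ord_hi i) (ord_hi i)).

(* beta is a positive root of sl_{n+1}, with coroot b. *)
Definition is_positive_root (C : fieldType) (n : nat)
  (beta : dual C 'rV[C]_n) (b : 'rV[C]_n) : Prop :=
  [/\ is_root (@sl C n) (@cartan_emb C n) beta,
      is_coroot (@sl C n) (@cartan_emb C n) beta b
    & exists c : 'I_n -> nat, beta = \sum_(i < n) simple_root C i *+ c i].

(** ** The order <=_s on a set O of weights, and its covering relation

   The values compared with 0 are integers; the order of a numFieldType is
   partial, and z > 0 in R[i] means that z is a positive real. *)

Inductive le_s (C : numFieldType) (n : nat) (O : set (dual C 'rV[C]_n)) :
  dual C 'rV[C]_n -> dual C 'rV[C]_n -> Prop :=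
| le_s_refl mu : O mu -> le_s O mu mu
| le_s_step mu beta b mu' : O mu -> is_positive_root beta b ->
    0 < (mu b : C) -> le_s O (reflection beta b mu) mu' -> le_s O mu mu'.

Definition covers_s (C : numFieldType) (n : nat) (O : set (dual C 'rV[C]_n))
  (mu mu' : dual C 'rV[C]_n) : Prop :=
  [/\ le_s O mu mu', mu <> mu'
    & forall nu, le_s O mu nu -> le_s O nu mu' -> nu = mu \/ nu = mu'].

(** * The poset Y_{m,n-m+1}, its filters and its coloring *)

Definition YT (m n : nat) : finType := ('I_m * 'I_(n - m).+1)%type.

Definition YT_le (m n : nat) (p q : YT m n) : bool :=
  (q.1 <= p.1)%N && (q.2 <= p.2)%N.

Definition is_filter (m n : nat) : set {set YT m n} :=
  [set Y : {set YT m n} | forall p q, p \in Y -> YT_le p q -> q \in Y].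

(* The color of a point, as an element of {1, ..., n}; the subtraction is not
   truncated. *)
Definition color (m n : nat) (p : YT m n) : nat := (p.2.+1 + m - p.1.+1)%N.

Definition is_colored_iso (C : numFieldType) (m n : nat)
  (O : set (dual C 'rV[C]_n)) (f : dual C 'rV[C]_n -> {set YT m n}) : Prop :=
  [/\ set_bij O (@is_filter m n) f,
      forall mu mu', O mu -> O mu' -> (le_s O mu mu' <-> f mu \subset f mu')
    & forall mu (i : 'I_n), O mu ->
        (covers_s O mu (simple_reflection i mu) <->
         exists p, f (simple_reflection i mu) :\: f mu = [set p]%SET
                   /\ color p = i.+1)].

(** * Folding *)

Definition sigma_row (C : fieldType) (n : nat) (h : 'rV[C]_n) : 'rV[C]_n :=
  \row_i h 0 (rev_ord i).

Fact sigma_row_is_linear (C : fieldType) n : linear (@sigma_row C n).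
Proof. by move=> a u v; apply/rowP => i; rewrite !mxE. Qed.

HB.instance Definition _ (C : fieldType) n :=
  GRing.isLinear.Build C 'rV[C]_n 'rV[C]_n *:%R (@sigma_row C n)
    (@sigma_row_is_linear C n).

Definition sigma_h (C : fieldType) (n : nat) : 'End('rV[C]_n) :=
  linfun (@sigma_row C n).

Lemma sigma_hE (C : fieldType) n (i : 'I_n) :
  sigma_h C n (simple_coroot C i) = simple_coroot C (rev_ord i).
Proof.
by rewrite lfunE; apply/rowP => j; rewrite !mxE !eqxx /= (can2_eq rev_ordK rev_ordK).
Qed.

Definition sigma_dual (C : fieldType) (n : nat) (mu : dual C 'rV[C]_n) :
  dual C 'rV[C]_n := (mu \o (sigma_h C n)^-1)%VF.

Definition weyl_hat (C : fieldType) (n : nat) :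
  set (dual C 'rV[C]_n -> dual C 'rV[C]_n) :=
  [set w | weyl_A w /\ @sigma_dual C n \o w =1 w \o @sigma_dual C n].

(* The automorphism of sl_{n+1} induced by sigma; the lemmas sigma_gl_* below
   show that it is the Lie algebra automorphism that permutes the Chevalley
   generators, and that it extends the action of sigma on the Cartan
   subalgebra. *)
Definition sigma_gl (C : fieldType) (n : nat) (x : 'M[C]_n.+1) :
  'M[C]_n.+1 :=
  \matrix_(a, b) - ((-1) ^+ (a + b) * x (rev_ord b) (rev_ord a)).

Definition fixed_sl (C : fieldType) (n : nat) : set 'M[C]_n.+1 :=
  [set x | sl x /\ sigma_gl x = x].

Definition h0 (C : fieldType) (n : nat) : {vspace 'rV[C]_n} :=
  fixedSpace (sigma_h C n).

Definition h0_emb (C : fieldType) (n : nat) (h : subvs_of (h0 C n)) :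
  'M[C]_n.+1 := cartan_emb (vsval h).

Definition weyl_tilde (C : fieldType) (n : nat) :
  set (dual C (subvs_of (h0 C n)) -> dual C (subvs_of (h0 C n))) :=
  weyl_group (@fixed_sl C n) (@h0_emb C n).

Definition res (C : fieldType) (n : nat) (mu : dual C 'rV[C]_n) :
  dual C (subvs_of (h0 C n)) :=
  (mu \o linfun (vsval : subvs_of (h0 C n) -> 'rV[C]_n))%VF.

(** ** Facts on sigma_gl *)

Lemma sigma_gl_is_linear (C : fieldType) n : linear (@sigma_gl C n).
Proof.
move=> a u v; apply/matrixP => i j; rewrite !mxE.
by rewrite mulrDr opprD mulrN !mulrA [a * _]mulrC.
Qed.

HB.instance Definition _ (C : fieldType) n :=
  GRing.isLinear.Build C 'M[C]_n.+1 'M[C]_n.+1 *:%R (@sigma_gl C n)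
    (@sigma_gl_is_linear C n).

Lemma sigma_glK (C : fieldType) n : involutive (@sigma_gl C n).
Proof.
move=> x; apply/matrixP => i j; rewrite !mxE !rev_ordK mulrN opprK mulrA.
rewrite -exprD /= !subSS.
suff -> : (i + j + (n - j + (n - i)) = (n + n))%N.
  by rewrite addnn -mul2n exprM sqrrN !expr1n mul1r.
have := ltn_ord i; have := ltn_ord j; rewrite !ltnS => jn iN.
by rewrite -addnA [(j + _)%N]addnA subnKC // addnCA subnKC.
Qed.

Lemma sigma_gl_bracket (C : fieldType) n (x y : 'M[C]_n.+1) :
  sigma_gl (bracket x y) = bracket (sigma_gl x) (sigma_gl y).
Proof.
have E (u v : 'M[C]_n.+1) : sigma_gl u *m sigma_gl v = - sigma_gl (v *m u).
  apply/matrixP => i j; rewrite !mxE opprK mulr_sumr.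
  rewrite (reindex_inj rev_ord_inj) /=; apply: eq_bigr => k _.
  rewrite !mxE rev_ordK mulrNN mulrACA -exprD.
  rewrite [v _ _ * _]mulrC; congr (_ * _).
by rewrite addnA -[(i + _ + _)%N]addnA addnn !exprD -mul2n exprM sqrrN
     !expr1n mulr1.
by rewrite /bracket !E linearB /= opprK addrC.
Qed.

Lemma rev_ord_lo n (i : 'I_n) : rev_ord (ord_lo i) = ord_hi (rev_ord i).
Proof. by apply: val_inj; rewrite /= /bump /= subSS add1n subnSK. Qed.

Lemma rev_ord_hi n (i : 'I_n) : rev_ord (ord_hi i) = ord_lo (rev_ord i).
Proof. by apply: val_inj; rewrite /= /bump /= add1n subSS. Qed.

Lemma sigma_gl_delta (C : fieldType) n (i j : 'I_n.+1) :
  sigma_gl (delta_mx i j) =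
  - ((-1) ^+ (rev_ord i + rev_ord j) *: delta_mx (rev_ord j) (rev_ord i))
  :> 'M[C]_n.+1.
Proof.
apply/matrixP => a b; rewrite !mxE ![rev_ord _ == _](can2_eq rev_ordK rev_ordK).
rewrite andbC; case: eqP => [->|] /=; last by rewrite !mulr0.
by case: eqP => [->|] /=; rewrite ?mulr0 // addnC.
Qed.

Lemma sigma_gl_e (C : fieldType) n (i : 'I_n) :
  sigma_gl (chevalley_e C i) = chevalley_e C (rev_ord i).
Proof.
rewrite sigma_gl_delta rev_ord_lo rev_ord_hi /= /bump /= add1n addSn addnn.
by rewrite exprS -mul2n exprM sqrrN !expr1n mulr1 scaleN1r opprK.
Qed.

Lemma sigma_gl_f (C : fieldType) n (i : 'I_n) :
  sigma_gl (chevalley_f C i) = chevalley_f C (rev_ord i).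
Proof.
rewrite sigma_gl_delta rev_ord_lo rev_ord_hi /= /bump /= add1n addnS addnn.
by rewrite exprS -mul2n exprM sqrrN !expr1n mulr1 scaleN1r opprK.
Qed.

Lemma sigma_gl_h (C : fieldType) n (h : 'rV[C]_n) :
  sigma_gl (cartan_emb h) = cartan_emb (sigma_h C n h).
Proof.
rewrite /cartan_emb linear_sum (reindex_inj rev_ord_inj) /=.
apply: eq_bigr => i _; rewrite lfunE mxE linearZ /= linearB /=.
rewrite !sigma_gl_delta !rev_ord_lo !rev_ord_hi !rev_ordK !addnn.
rewrite -!mul2n !exprM !sqrrN !expr1n !scale1r.
by rewrite opprK addrC.
Qed.

(** * The two families of filters *)

(* ft is the map f~; its values outside of the orbit of res lambda under the
   Weyl group of the fixed-point subalgebra are irrelevant. *)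
Definition F_tilde (C : fieldType) (m n : nat) (lambda : dual C 'rV[C]_n)
  (ft : dual C (subvs_of (h0 C n)) -> {set YT m n}) : set {set YT m n} :=
  ft @` orbit_of (@weyl_tilde C n) (res lambda).

Definition row_len (m n : nat) (Y : {set YT m n}) (l : 'I_m) : nat :=
  #|[set j | (l, j) \in Y]%SET|.

Definition I_set (m n : nat) (Y : {set YT m n}) : set nat :=
  [set (row_len Y i + m + 1 - i.+1)%N | i in [set: 'I_m]].

Definition I_bar (m n : nat) (Y : {set YT m n}) : set nat :=
  [set (n + 2 - i)%N | i in I_set Y].

Definition SS (m n : nat) : set {set YT m n} :=
  [set Y : {set YT m n} | is_filter Y /\ I_set Y `&` I_bar Y = set0].

(* Main.v *)
From HB Require Import structures.
Require Import Defs.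
From mathcomp Require Import classical_sets functions reals complex.
From mathcomp Require Import all_boot all_order all_fingroup all_algebra.
From mathcomp Require Import zify ring.

(** The Cartan subalgebra consists of the trace-zero diagonal matrices, and
    the weights in the orbit of the fundamental weight are the sums wt S of
    the coordinate functions eps c over the m-element sets S of indices
    (weyl_orbitP); the simple reflection s_i acts on S by exchanging i and
    i+1. The idea is to read both families of filters off S.

    The map f. The element rho, on which every simple root is 2, turns le_s
    into a comparison of the sums of the elements of the sets S, so moving one
    element of S from i to i+1 is a covering (adj_swap_covers), and it adds to
    the filter one point of the color of i. Adding a point in row l raises
    k_l + m + 1 - l from that color to the next number and keeps the other row
    indices. Since f sends the least weight to the empty filter, an induction
    along these moves shows that I (f (wt S)) is S, up to the shift between
    indices that start at 0 and at 1 (mem_colored_iso). The involution of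
    {1, ..., n+1} that defines I_bar is c |-> rev c on indices, hence f (wt S)
    lies in SS exactly when S is disjoint from its image under rev
    (SS_admissible); such sets are called admissible.

    The folded side. On h0 one has eps (rev c) = - eps c. Computing the root
    vectors of the fixed-point subalgebra entry by entry shows that every
    reflection of its Weyl group permutes the restrictions of the eps c
    through a permutation that commutes with rev
    (folded_reflection_acts_by). These permutations preserve admissibility,
    and the initial segment of length m is admissible because 2m <= n+1; hence
    every element of F_tilde lies in SS, once the admissible weights are known
    to lie in the orbit of weyl_hat.

    Conversely, the flips (a, rev a) and the double transpositions
    (a, d)(rev a, rev d) connect any two admissible sets of the same size
    (admissible_ind). Each of them is induced by an element of W that commutes
    with sigma, and also by the reflection in the root of the fixed-point
    subalgebra carried by the vector z + sigma z, for an elementary matrix z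
    (tilde_perm_generator). So the admissible weights lie in the orbit of
    weyl_hat and their restrictions in the orbit of weyl_tilde, which gives
    the other inclusion. *)

Set Implicit Arguments.
Unset Strict Implicit.
Unset Printing Implicit Defensive.

Import Order.TTheory GRing.Theory Num.Theory.
Local Open Scope ring_scope.

(** * Weights as sums of coordinate functions *)

Lemma sum_indic (R : pzSemiRingType) (T : finType) (A : {set T}) (x : T) :
  \sum_(c in A) (c == x)%:R = (x \in A)%:R :> R.
Proof.
case: (boolP (x \in A)) => xA.
  by rewrite (bigD1 x) //= eqxx big1 ?addr0 // => c /andP[_ /negPf->].
by rewrite big1 // => c cA; case: eqP xA => // <-; rewrite cA.
Qed.

Section Coordinates.
Variables (C : numFieldType) (n : nat).
Implicit Types (a b c d : 'I_n.+1) (S T : {set 'I_n.+1}) (h : 'rV[C]_n)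
  (mu nu : dual C 'rV[C]_n) (v : 'I_n.+1 -> C).

(** The c-th diagonal entry of a trace-zero diagonal matrix, in terms of the
    basis of simple coroots (see cartan_embE). *)
Definition eps c : dual C 'rV[C]_n :=
  \sum_(j < n) ((c == ord_lo j)%:R - (c == ord_hi j)%:R : C) *:
    fundamental_weight C j.

Definition wt S : dual C 'rV[C]_n := \sum_(c in S) eps c.

Lemma fundamental_weight_coord (j : 'I_n) h :
  fundamental_weight C j h = h 0 j :> C.
Proof. by rewrite lfunE. Qed.

Lemma eps_coord c h : eps c h =
  \sum_(j < n) ((c == ord_lo j)%:R - (c == ord_hi j)%:R) * h 0 j :> C.
Proof.
rewrite sum_lfunE; apply: eq_bigr => j _.
by rewrite scale_lfunE fundamental_weight_coord.
Qed.

Lemma eps_simple_coroot c (j : 'I_n) : eps c (simple_coroot C j) =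
  (c == ord_lo j)%:R - (c == ord_hi j)%:R :> C.
Proof.
rewrite eps_coord (bigD1 j) //= big1 ?addr0 => [|i ij].
  by rewrite mxE !eqxx mulr1.
by rewrite mxE eqxx (negPf ij) mulr0.
Qed.

Lemma dual_ext mu nu :
  (forall j, mu (simple_coroot C j) = nu (simple_coroot C j)) -> mu = nu.
Proof.
move=> E; apply/lfunP => h; rewrite (row_sum_delta h) !linear_sum.
by apply: eq_bigr => j _; rewrite !linearZ /= [mu _]E.
Qed.

Lemma wt_simple_coroot S (j : 'I_n) : wt S (simple_coroot C j) =
  (ord_lo j \in S)%:R - (ord_hi j \in S)%:R :> C.
Proof.
rewrite -2!sum_indic -sumrB sum_lfunE.
by apply: eq_bigr => c _; rewrite eps_simple_coroot.
Qed.

Lemma fundamental_weight_wt (k : 'I_n) :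
  fundamental_weight C k = wt [set c : 'I_n.+1 | c < k.+1]%N.
Proof.
apply: dual_ext => j; rewrite wt_simple_coroot fundamental_weightE.
rewrite !inE /= /bump /= add1n !ltnS.
by rewrite [(j <= k)%N]leq_eqVlt -val_eqE /= eq_sym; case: ltngtP;
  rewrite ?subrr ?subr0.
Qed.

Lemma simple_root_eps (i : 'I_n) :
  simple_root C i = eps (ord_lo i) - eps (ord_hi i).
Proof.
apply: dual_ext => j; rewrite simple_rootE add_lfunE opp_lfunE.
rewrite !eps_simple_coroot /cartan_entry.
rewrite -!val_eqE /= /bump /= !add1n eqSS.
rewrite [(i.+1 == j)]eq_sym.
case: (ltngtP j i) => [ji|ij|->] /=; last first.
- by rewrite (ltn_eqF (ltnSn i)) ?(gtn_eqF (ltnSn i)) /=; ring.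
- rewrite ?(gtn_eqF (leqW ij)) ?(ltn_eqF (leqW ij)) /=.
  by case: eqP => _ /=; ring.
- rewrite ?(gtn_eqF (leqW ji)) ?(ltn_eqF (leqW ji)) ?orbF.
  rewrite [(j.+1 == i)]eq_sym /=.
  by case: eqP => _ /=; ring.
Qed.

(** The element of the Cartan subalgebra with diagonal entries v: its
    coordinates on the simple coroots are the partial sums of v. *)
Definition cochar v : 'rV[C]_n :=
  \row_(j < n) \sum_(d < n.+1 | (d <= j)%N) v d.

Lemma eps_cochar v c : \sum_d v d = 0 -> eps c (cochar v) = v c :> C.
Proof.
move=> v0; pose F k := \sum_(d : 'I_n.+1 | (d < k)%N) v d.
have F0 : F 0%N = 0 by rewrite /F big_pred0.
have Fn : F n.+1 = 0.
  by rewrite -[RHS]v0; apply: eq_bigl => d; rewrite ltn_ord.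
have L : \sum_(j < n) (c == ord_lo j)%:R * F j.+1 = F c.+1.
  have -> : F c.+1 = \sum_(j < n.+1) (c == j)%:R * F j.+1.
    rewrite (bigD1 c) //= eqxx mul1r big1 ?addr0 // => i ic.
    by rewrite eq_sym (negPf ic) mul0r.
  rewrite big_ord_recr /= Fn mulr0 addr0.
  by apply: eq_bigr => j _; congr ((c == _)%:R * _); apply: val_inj.
have H : \sum_(j < n) (c == ord_hi j)%:R * F j.+1 = F c.
  have -> : F c = \sum_(j < n.+1) (c == j)%:R * F j.
    rewrite (bigD1 c) //= eqxx mul1r big1 ?addr0 // => i ic.
    by rewrite eq_sym (negPf ic) mul0r.
  by rewrite big_ord_recl F0 mulr0 add0r.
rewrite eps_coord -[RHS](addrK (F c)).
have <- : F c.+1 = v c + F c.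
  rewrite /F (bigD1 c) ?ltnSn //=; congr (_ + _); apply: eq_bigl => d.
  by rewrite ltnS [(d < c)%N]ltn_neqAle andbC.
rewrite -L -H -sumrB; apply: eq_bigr => j _.
by rewrite mxE -mulrBl.
Qed.

(** Values that are odd under the reversal of the indices come in opposite
    pairs, which is how all the diagonal matrices below are seen to have trace
    zero. *)
Lemma antisym_sum v : (forall c, v (rev_ord c) = - v c) -> \sum_c v c = 0.
Proof.
move=> vN; set s := \sum_c v c.
have /eqP : s *+ 2 = 0; last by rewrite mulrn_eq0 => /eqP.
rewrite mulr2n {1}/s (reindex_inj rev_ord_inj) -big_split /= big1 // => c _.
by rewrite vN addNr.
Qed.

Lemma wt_cochar v S :
  \sum_d v d = 0 -> wt S (cochar v) = \sum_(c in S) v c :> C.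
Proof.
by move=> v0; rewrite sum_lfunE; apply: eq_bigr => c _; rewrite eps_cochar.
Qed.

(** The only linear relation between the eps c is that their sum is 0, and two
    sets of the same size cannot differ by a multiple of it: the diagonal
    matrix with entries 1 at a and -1 at b separates wt S from wt T when a lies
    in S only and b in T only. *)
Lemma wt_inj S T : #|S| = #|T| -> wt S = wt T -> S = T.
Proof.
move=> cST E; apply/eqP; rewrite eqEcard cST leqnn andbT.
apply/subsetP => a aS; apply/negPn/negP => aT.
have /subsetPn[b bT bS] : ~~ (T \subset S).
  apply: contra aT => TS; suff -> : T = S by [].
  by apply/eqP; rewrite eqEcard TS cST leqnn.
pose v c : C := (c == a)%:R - (c == b)%:R.
have DU (U : {set 'I_n.+1}) : \sum_(c in U) v c = (a \in U)%:R - (b \in U)%:R.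
  by rewrite /v sumrB !sum_indic.
have v0 : \sum_d v d = 0.
  have := DU [set: 'I_n.+1]%SET; rewrite !in_setT subrr.
  by under eq_bigl do rewrite in_setT.
have := congr1 (fun mu : dual C 'rV[C]_n => mu (cochar v) : C) E.
rewrite !wt_cochar // !DU aS bT (negPf aT) (negPf bS) subr0 sub0r => /eqP.
by rewrite -subr_eq0 opprK -natrD pnatr_eq0.
Qed.

Lemma cartan_embE h a b : cartan_emb h a b = (eps a h : C) *+ (a == b).
Proof.
rewrite summxE eps_coord -sumrMnl; apply: eq_bigr => j _; rewrite !mxE.
rewrite mulrC; case: (eqVneq a b) => [<-|ab]; rewrite ?mulr1n ?andbb //.
rewrite mulr0n.
have N x : (a == x) && (b == x) = false.
  by apply/negP => /andP[/eqP ax /eqP bx]; rewrite ax bx eqxx in ab.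
by rewrite !N subrr mul0r.
Qed.

Lemma row_eq_eps h h' : (forall c, eps c h = eps c h') -> h = h'.
Proof.
move=> E; apply/rowP => j; rewrite -!fundamental_weight_coord.
by rewrite fundamental_weight_wt !sum_lfunE; apply: eq_bigr => c _.
Qed.

Lemma bracket_cartan h (x : 'M[C]_n.+1) a b :
  bracket (cartan_emb h) x a b = (eps a h - eps b h : C) * x a b.
Proof.
have -> : cartan_emb h = diag_mx (\row_c (eps c h : C)).
  by apply/matrixP => c d; rewrite cartan_embE mxE [in RHS]mxE.
rewrite /bracket mul_diag_mx mul_mx_diag !mxE; ring.
Qed.

End Coordinates.

(** * Linear maps that permute a family of vectors *)

Section PermutationAction.
Variables (C : fieldType) (V : vectType C) (I : finType) (e : I -> dual C V).
Implicit Types (w : dual C V -> dual C V) (p q : {perm I}).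

(** Both Weyl groups are studied through their action on the eps c and on the
    restrictions of the eps c. These vectors are linearly dependent, so the
    linearity of w has to be carried along. *)
Definition acts_by w p := linear w /\ forall c, w (e c) = e (p c).

Lemma acts_by_id : acts_by id 1.
Proof. by split=> // c; rewrite perm1. Qed.

Lemma acts_by_comp w1 w2 p1 p2 :
  acts_by w1 p1 -> acts_by w2 p2 -> acts_by (w1 \o w2) (p2 * p1)%g.
Proof.
move=> [L1 E1] [L2 E2]; split=> [a u v|c] /=; first by rewrite L2 L1.
by rewrite E2 E1 permM.
Qed.

Lemma acts_by_sum w p (A : {set I}) :
  acts_by w p -> w (\sum_(c in A) e c) = \sum_(c in p @: A) e c.
Proof.
move=> [L E].
pose wL : {linear dual C V -> dual C V} :=
  HB.pack w (GRing.isLinear.Build C _ _ _ w L).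
rewrite big_imset /=; last by move=> x y _ _; apply: perm_inj.
by rewrite -[w]/(wL : _ -> _) linear_sum; apply: eq_bigr => c _; apply: E.
Qed.

Lemma reflection_acts_by (beta : dual C V) b p :
  (forall c, e c - (e c b : C) *: beta = e (p c)) ->
  acts_by (reflection beta b) p.
Proof.
move=> E; split=> // a u v; rewrite /reflection add_lfunE scale_lfunE.
by rewrite scalerDl scalerBr opprD addrACA scalerA.
Qed.

End PermutationAction.

(** * Moving an element of a set of indices to the next index *)

Section Permutations.
Variable n : nat.
Implicit Types (S T : {set 'I_n.+1}).

Lemma ord_lo_neq_hi (i : 'I_n) : ord_lo i != ord_hi i.
Proof. by rewrite -val_eqE /= /bump /= add1n ltn_eqF. Qed.

Definition adj_swap (i : 'I_n) : {perm 'I_n.+1} := tperm (ord_lo i) (ord_hi i).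

Definition initial m : {set 'I_n.+1} := [set c : 'I_n.+1 | (c < m)%N].

Lemma card_initial m : (m <= n.+1)%N -> #|initial m| = m.
Proof.
move=> mn; rewrite -sum1dep_card -(big_ord_widen n.+1 (fun=> 1%N) mn).
by rewrite sum1_card card_ord.
Qed.

(** A set without descent is closed downwards, hence an initial segment. Used
    for subsets of the indices, and for the rows of a filter. *)
Lemma initial_or_descent S :
  S = initial #|S| \/ exists i : 'I_n, ord_lo i \notin S /\ ord_hi i \in S.
Proof.
case: (boolP [exists i : 'I_n, (ord_lo i \notin S) && (ord_hi i \in S)]).
  by case/existsP => i /andP[]; right; exists i.
move/existsPn => noD; left.
have down k (c d : 'I_n.+1) : c \in S -> (d + k)%N = c -> d \in S.
  elim: k d => [|k IH] d cS dc.
    by rewrite (_ : d = c) //; apply: val_inj; rewrite /= -dc addn0.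
  have dn : (d < n)%N by have := ltn_ord c; lia.
  have := noD (Ordinal dn); rewrite negb_and negbK => /orP[|].
    by rewrite (_ : ord_lo _ = d) //; apply: val_inj.
  rewrite (IH (ord_hi _)) //= /bump /= add1n; lia.
apply/eqP; rewrite eqEcard card_initial ?leqnn ?andbT; last first.
  by rewrite -[X in (_ <= X)%N]card_ord max_card.
apply/subsetP => c cS; rewrite inE.
rewrite -(@card_initial c.+1) //; apply/subset_leq_card/subsetP => d.
by rewrite inE ltnS => dc; apply: (down (c - d)%N c); rewrite // subnKC.
Qed.

Lemma sum_adj (i : 'I_n) T : ord_lo i \in T -> ord_hi i \notin T ->
  (\sum_(c in adj_swap i @: T) c = (\sum_(c in T) c).+1)%N.
Proof.
move=> lT hT; rewrite big_imset /=; last by move=> x y _ _; apply: perm_inj.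
rewrite (bigD1 (ord_lo i)) //= [in RHS](bigD1 (ord_lo i)) //= tpermL /=.
rewrite /bump /= add1n addSn; congr (_ + _).+1.
apply: eq_bigr => c /andP[cT cl].
rewrite tpermD // 1?eq_sym //.
by apply: contraNneq hT => <-.
Qed.

Lemma adjK (i : 'I_n) T : adj_swap i @: (adj_swap i @: T) = T.
Proof.
rewrite -imset_comp (eq_imset (g := id)) ?imset_id // => c /=.
exact: tpermK.
Qed.

Lemma mem_adj_lo (i : 'I_n) T :
  (ord_lo i \in adj_swap i @: T) = (ord_hi i \in T).
Proof.
rewrite -{1}(tpermR (ord_lo i) (ord_hi i)) mem_imset //.
exact: perm_inj.
Qed.

Lemma mem_adj_hi (i : 'I_n) T :
  (ord_hi i \in adj_swap i @: T) = (ord_lo i \in T).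
Proof.
rewrite -{1}(tpermL (ord_lo i) (ord_hi i)) mem_imset //.
exact: perm_inj.
Qed.

Lemma card_perm_imset (p : {perm 'I_n.+1}) S : #|p @: S| = #|S|.
Proof. exact/card_imset/perm_inj. Qed.

(** Every m-element set is reached from the initial segment by moves from i to
    i+1: the backward move at a descent lowers the sum of the elements. *)
Lemma adj_ind m (P : {set 'I_n.+1} -> Prop) :
    P (initial m) ->
    (forall (i : 'I_n) T, #|T| = m -> ord_lo i \in T -> ord_hi i \notin T ->
       P T -> P (adj_swap i @: T)) ->
  forall S, #|S| = m -> P S.
Proof.
move=> P0 PS S; have [s] := ubnP (\sum_(c in S) c)%N.
elim: s S => // s IH S Ss cS.
case: (initial_or_descent S) => [->|[i [li hi]]]; first by rewrite cS.
have := @sum_adj i (adj_swap i @: S); rewrite mem_adj_lo mem_adj_hi adjK li hi.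
move=> /(_ isT isT) E.
rewrite -(adjK i S); apply: PS;
  rewrite ?card_perm_imset ?mem_adj_lo ?mem_adj_hi //.
by apply: IH; rewrite ?card_perm_imset // -ltnS -E.
Qed.

End Permutations.

(** * The orbit of a fundamental weight in type A and its order *)

Section TypeA.
Variables (C : numFieldType) (n : nat).
Implicit Types (i : 'I_n) (a c d : 'I_n.+1) (S T : {set 'I_n.+1}) (h : 'rV[C]_n)
  (mu nu : dual C 'rV[C]_n).
Local Notation eps := (@eps C n).
Local Notation wt := (@wt C n).

Lemma simple_reflection_acts_by (i : 'I_n) :
  acts_by eps (@simple_reflection C n i) (adj_swap i).
Proof.
apply: reflection_acts_by => c; rewrite eps_simple_coroot simple_root_eps.
have hl := negPf (ord_lo_neq_hi i).
rewrite /adj_swap; case: tpermP => [->|->|/eqP/negPf-> /eqP/negPf->].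
- by rewrite eqxx hl subr0 scale1r subKr.
- by rewrite eqxx eq_sym hl sub0r scaleN1r opprK addrC subrK.
- by rewrite subrr scale0r subr0.
Qed.

Lemma simple_reflection_wt (i : 'I_n) S :
  simple_reflection i (wt S) = wt (adj_swap i @: S).
Proof. exact: acts_by_sum (simple_reflection_acts_by i). Qed.

Definition weyl_perm (p : {perm 'I_n.+1}) :=
  exists2 w, @weyl_A C n w & acts_by eps w p.

Lemma weyl_A_comp (w1 w2 : dual C 'rV[C]_n -> dual C 'rV[C]_n) :
  weyl_A w1 -> weyl_A w2 -> weyl_A (w1 \o w2).
Proof.
move=> W1 W2; elim: W1 => [//|s w Ss _ IH].
exact: (generated_comp Ss IH).
Qed.

Lemma weyl_permM p q : weyl_perm p -> weyl_perm q -> weyl_perm (p * q)%g.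
Proof.
move=> [w Ww wp] [w' Ww' wq]; exists (w' \o w); first exact: weyl_A_comp.
exact: acts_by_comp.
Qed.

Lemma weyl_perm_adj i : weyl_perm (adj_swap i).
Proof.
exists (@simple_reflection C n i); last exact: simple_reflection_acts_by.
by apply: (@generated_comp _ _ (simple_reflection i) id);
  [exists i|exact: generated_id].
Qed.

(** The adjacent transpositions generate: conjugating (a, b-1) by (b-1, b)
    gives (a, b). *)
Lemma weyl_perm_tperm (a b : 'I_n.+1) : weyl_perm (tperm a b).
Proof.
wlog ab : a b / (a <= b)%N.
  by move=> H; case/orP: (leq_total a b) => /H //; rewrite tpermC.
have : (a + (b - a) = b)%N by rewrite subnKC.
move: (b - a)%N => k; elim: k b ab => [|k IH] b ab kb.
  have -> : b = a by apply: val_inj; rewrite /= -kb addn0.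
  by rewrite tperm1; exists id; [exact: generated_id|exact: acts_by_id].
have bn : (b.-1 < n)%N by have := ltn_ord b; lia.
pose i := Ordinal bn.
have -> : b = ord_hi i by apply: val_inj; rewrite /= /bump /= add1n; lia.
case: (eqVneq a (ord_lo i)) => [->|al]; first exact: weyl_perm_adj.
have ah : a != ord_hi i by rewrite -val_eqE /= /bump /= add1n; lia.
have -> : tperm a (ord_hi i) = (tperm a (ord_lo i) ^ adj_swap i)%g.
  by rewrite tpermJ tpermL tpermD // eq_sym.
rewrite conjgE tpermV; apply: weyl_permM; first exact: weyl_perm_adj.
by apply: weyl_permM; [apply: IH => /=; lia|exact: weyl_perm_adj].
Qed.

Lemma weyl_A_acts_by (w : dual C 'rV[C]_n -> dual C 'rV[C]_n) :
  weyl_A w -> exists p, acts_by eps w p.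
Proof.
elim=> [|s w' [i ->] _ [p wp]]; first by exists 1%g; exact: acts_by_id.
exists (p * adj_swap i)%g.
exact: acts_by_comp (simple_reflection_acts_by i) wp.
Qed.

Lemma weyl_orbitP (k : 'I_n) mu :
  orbit_of (@weyl_A C n) (fundamental_weight C k) mu <->
  exists2 S : {set 'I_n.+1}, #|S| = k.+1 & mu = wt S.
Proof.
have kn : (k.+1 <= n.+1)%N by rewrite ltnW // ltnS ltn_ord.
rewrite fundamental_weight_wt -/(initial n k.+1); split.
  case=> w /weyl_A_acts_by[p wp] <-; exists (p @: initial n k.+1).
    by rewrite card_perm_imset card_initial.
  exact: acts_by_sum.
case=> S cS ->; elim/adj_ind: S / cS.
  by exists id => //; exact: generated_id.
move=> i T _ _ _ [w Ww wT]; exists (simple_reflection i \o w).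
  by apply: generated_comp Ww; exists i.
by rewrite /= wT simple_reflection_wt.
Qed.

(** The sum of the positive coroots, which measures heights: wt S takes on it
    a value that depends on the size and on the sum of S only (wt_rho). *)
Definition rho := cochar (fun c : 'I_n.+1 => n%:R - (2 * c)%:R : C).

Lemma rho_sum0 : \sum_(c < n.+1) (n%:R - (2 * c)%:R : C) = 0.
Proof.
apply: antisym_sum => c /=; have := leq_ord c => cn.
by rewrite subSS mulnBr !natrB ?leq_mul //; ring.
Qed.

Lemma simple_root_rho i : simple_root C i rho = 2 :> C.
Proof.
rewrite simple_root_eps add_lfunE opp_lfunE !eps_cochar ?rho_sum0 //=.
by rewrite /bump /= add1n; ring.
Qed.

Lemma wt_rho S : wt S rho =
  (#|S| * n)%:R - (2 * \sum_(c in S) c)%:R :> C.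
Proof.
rewrite wt_cochar ?rho_sum0 // sumrB sumr_const -mulrnA mulnC; congr (_ - _).
by rewrite big_distrr natr_sum.
Qed.

(** A positive root is a nonzero sum of simple roots, each of which takes the
    value 2 on rho. This makes le_s strictly decreasing along rho without
    determining the positive roots. *)
Lemma positive_root_rho beta b : is_positive_root beta b -> 0 < (beta rho : C).
Proof.
case=> -[beta0 _] _ [x E].
have -> : beta rho = (2 * \sum_i x i)%:R :> C.
  rewrite E sum_lfunE big_distrr natr_sum; apply: eq_bigr => i _ /=.
  by rewrite -scaler_nat scale_lfunE simple_root_rho mulnC natrM.
rewrite ltr0n muln_gt0 /= lt0n; apply: contraNneq beta0 => /eqP.
rewrite sum_nat_eq0 => /forallP x0; rewrite E big1 // => i _.
by rewrite (eqP (x0 i)) mulr0n.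
Qed.

Lemma le_s_rho O mu mu' : le_s O mu mu' ->
  mu = mu' \/ (mu' rho : C) < (mu rho : C).
Proof.
elim=> [nu _|nu beta b nu' _ pos nub _ IH]; first by left.
right; have lt : reflection beta b nu rho < nu rho :> C.
  rewrite /reflection add_lfunE opp_lfunE scale_lfunE ltrBlDr ltrDl.
  exact: mulr_gt0 nub (positive_root_rho pos).
by case: IH => [<- //|]; move/lt_trans; apply.
Qed.

Lemma bracket_cartan_delta h (a b : 'I_n.+1) :
  bracket (cartan_emb h) (delta_mx a b) =
  (eps a h - eps b h : C) *: delta_mx a b.
Proof.
apply/matrixP => c d; rewrite bracket_cartan !mxE.
by case: (eqVneq c a) => [->|_]; case: (eqVneq d b) => [->|_]; rewrite ?mulr0.
Qed.

Lemma sl_delta (a b : 'I_n.+1) : a != b -> sl (delta_mx a b : 'M[C]_n.+1).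
Proof.
move=> ab; rewrite /sl /= /mxtrace big1 // => c _; rewrite mxE.
by case: (eqVneq c a) => [->|//]; rewrite (negPf ab).
Qed.

Lemma bracket_delta (a b : 'I_n.+1) : bracket (delta_mx a b) (delta_mx b a) =
  delta_mx a a - delta_mx b b :> 'M[C]_n.+1.
Proof. by rewrite /bracket !mul_delta_mx. Qed.

Lemma cartan_emb_simple_coroot i : cartan_emb (simple_coroot C i) =
  delta_mx (ord_lo i) (ord_lo i) - delta_mx (ord_hi i) (ord_hi i).
Proof.
rewrite /cartan_emb (bigD1 i) //= big1 ?addr0 => [|j ji].
  by rewrite mxE !eqxx scale1r.
by rewrite mxE (negPf ji) andbF scale0r.
Qed.

Lemma simple_root_positive i :
  is_positive_root (simple_root C i) (simple_coroot C i).
Proof.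
have rt : root_space (@sl C n) (@cartan_emb C n) (simple_root C i)
            (chevalley_e C i).
  split=> [|h]; first exact/sl_delta/ord_lo_neq_hi.
  by rewrite bracket_cartan_delta simple_root_eps add_lfunE opp_lfunE.
split.
- split; last exists (chevalley_e C i) => //.
    apply/eqP => /(congr1 (fun mu : dual C 'rV[C]_n => mu rho : C)) /eqP.
    by rewrite simple_root_rho zero_lfunE pnatr_eq0.
  apply/eqP => /matrixP/(_ (ord_lo i) (ord_hi i))/eqP.
  by rewrite !mxE !eqxx oner_eq0.
- split; last by rewrite simple_rootE /cartan_entry eqxx.
  exists (chevalley_e C i), (chevalley_f C i); split=> //.
    split=> [|h]; first by apply: sl_delta; rewrite eq_sym ord_lo_neq_hi.
    rewrite bracket_cartan_delta simple_root_eps.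
    by rewrite opprB add_lfunE opp_lfunE.
  by rewrite bracket_delta cartan_emb_simple_coroot.
- exists (fun j => (j == i) : nat).
  rewrite (bigD1 i) //= eqxx mulr1n big1 ?addr0 // => j /negPf->.
  by rewrite mulr0n.
Qed.

(** Moving an element of T from i to i+1 raises the sum of T by one, and le_s
    raises this natural number strictly, so that nothing fits in between. *)
Lemma adj_swap_covers (k i : 'I_n) T : #|T| = k.+1 ->
    ord_lo i \in T -> ord_hi i \notin T ->
  covers_s (orbit_of (@weyl_A C n) (fundamental_weight C k))
    (wt T) (simple_reflection i (wt T)).
Proof.
move=> cT lT hT; set O := orbit_of _ _.
have OT : O (wt T) by apply/weyl_orbitP; exists T.
have OT' : O (wt (adj_swap i @: T)).
  by apply/weyl_orbitP; exists (adj_swap i @: T); rewrite ?card_perm_imset.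
have le : le_s O (wt T) (wt (adj_swap i @: T)).
  apply: (le_s_step OT (simple_root_positive i)).
    by rewrite wt_simple_coroot lT (negPf hT) subr0.
  by rewrite -/(simple_reflection i _) simple_reflection_wt; exact: le_s_refl.
have lt (U U' : {set 'I_n.+1}) : #|U| = k.+1 -> #|U'| = k.+1 ->
    wt U' rho < wt U rho :> C ->
    (\sum_(c in U) c < \sum_(c in U') c)%N.
  move=> cU cU'; rewrite !wt_rho cU cU' ltrD2l ltrN2 ltr_nat.
  by rewrite ltn_mul2l.
rewrite simple_reflection_wt; split=> //.
  move/(wt_inj (esym (card_perm_imset _ _))) => E.
  by have := sum_adj lT hT; rewrite -E; lia.
move=> nu le1 le2.
have [U cU EU] : exists2 U : {set 'I_n.+1}, #|U| = k.+1 & nu = wt U.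
  by apply/weyl_orbitP; case: le2.
subst nu.
case: (le_s_rho le1) => [->|/lt l1]; first by left.
case: (le_s_rho le2) => [->|/lt l2]; first by right.
have := l1 cT cU; have := l2 cU; rewrite card_perm_imset => /(_ cT).
by rewrite (sum_adj lT hT); lia.
Qed.

End TypeA.

(** * Rows of a filter *)

Section Filters.
Variables (m n : nat).
Implicit Types (Y : {set YT m n}) (l : 'I_m).

Definition row_index Y l := (row_len Y l + m + 1 - l.+1)%N.

Lemma mem_filter_row Y l (j : 'I_(n - m).+1) :
  is_filter Y -> ((l, j) \in Y) = (j < row_len Y l)%N.
Proof.
move=> FY; rewrite /row_len; set A := [set j | _].
have -> : ((l, j) \in Y) = (j \in A) by rewrite inE.
have [EA|[i []]] := initial_or_descent A; first by rewrite {1}EA inE.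
rewrite !inE => /negP nlo hi; case: nlo; apply: (FY _ _ hi).
by rewrite /YT_le leqnn /= /bump leq_addl.
Qed.

Lemma row_len_antitone Y l l' :
  is_filter Y -> (l <= l')%N -> (row_len Y l' <= row_len Y l)%N.
Proof.
move=> FY ll; apply/subset_leq_card/subsetP => j; rewrite !inE => /FY; apply.
by rewrite /YT_le ll leqnn.
Qed.

(** The rows of a filter get shorter downwards, so the row indices decrease
    strictly. *)
Lemma row_index_inj Y : is_filter Y -> injective (row_index Y).
Proof.
move=> FY.
have lt l l' : (l < l')%N -> row_index Y l <> row_index Y l'.
  move=> ll; have := row_len_antitone FY (ltnW ll).
  by rewrite /row_index; have := ltn_ord l; have := ltn_ord l'; lia.
move=> l l' E; apply: val_inj; case: (ltngtP l l') => // /lt; first by [].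
by rewrite E.
Qed.

Section AddPoint.
Variables (Y Y' : {set YT m n}) (p : YT m n).
Hypotheses (FY : is_filter Y) (FY' : is_filter Y') (sub : Y \subset Y')
  (diff : Y' :\: Y = [set p]).

Lemma add_point_notin : p \notin Y.
Proof. by have := set11 p; rewrite -diff inE => /andP[]. Qed.

Lemma add_pointE : Y' = p |: Y.
Proof.
by rewrite -diff setUC setDE setUIr setUCr setIT; apply/esym/setUidPr.
Qed.

Lemma row_len_add_point l : row_len Y' l = (row_len Y l + (l == p.1))%N.
Proof.
rewrite /row_len add_pointE; case: eqP => [->|/eqP lp].
  rewrite (_ : [set j | _] = p.2 |: [set j | (p.1, j) \in Y]).
    by rewrite cardsU1 inE -surjective_pairing add_point_notin addnC.
  by apply/setP => j; rewrite !inE -[in LHS]pair_eqE /= eqxx.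
rewrite addn0; apply: eq_card => j; rewrite !inE -pair_eqE /=.
by rewrite (negPf lp).
Qed.

Lemma row_len_at_point : row_len Y p.1 = p.2.
Proof.
have := add_point_notin; rewrite [p]surjective_pairing mem_filter_row //=.
have : p \in Y' by rewrite add_pointE setU11.
rewrite [X in X \in _]surjective_pairing mem_filter_row //.
rewrite row_len_add_point eqxx addn1 ltnS -leqNgt => le ge.
by apply/eqP; rewrite eqn_leq le ge.
Qed.

(** The new point is the end of its row, so its color is the row index before
    the addition. *)
Lemma row_index_at_point : row_index Y p.1 = color p.
Proof. by rewrite /row_index row_len_at_point /color; lia. Qed.

Lemma row_index_add_point l : row_index Y' l = (row_index Y l + (l == p.1))%N.
Proof.
by rewrite /row_index row_len_add_point; have := ltn_ord l; lia.
Qed.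

End AddPoint.

End Filters.

(** * The row indices of the filter attached to a weight *)

Section ColoredIso.
Variables (C : numFieldType) (m n : nat) (k : 'I_n) (hk : k.+1 = m).
Local Notation O :=
  (orbit_of (@weyl_A C n) (fundamental_weight C k)).
Variable f : dual C 'rV[C]_n -> {set YT m n}.
Hypothesis hf : is_colored_iso O f.
Implicit Types (S T : {set 'I_n.+1}).

Lemma orbit_wt S : #|S| = m -> O (wt C S).
Proof. by move=> cS; apply/weyl_orbitP; exists S; rewrite ?hk. Qed.

Lemma colored_iso_filter S : #|S| = m -> is_filter (f (wt C S)).
Proof. by case: hf => -[fF _ _] _ _ /orbit_wt; apply: fF. Qed.

(** The weight sent to the empty filter is least, and a weight whose set has a
    descent is not, since undoing the descent gives a smaller one. *)
Lemma colored_iso_initial : f (wt C (initial n m)) = set0.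
Proof.
have [[fF fI fS] fle fcov] := hf.
have [mu0 Omu0 f0] : exists2 mu0, O mu0 & f mu0 = set0.
  have [|mu Omu fmu] := fS set0; last by exists mu.
  by move=> p q; rewrite in_set0.
have /weyl_orbitP[S cS Emu] := Omu0; rewrite hk in cS; subst mu0.
case: (initial_or_descent S) => [ES|[i [li hi]]].
  by rewrite cS in ES; rewrite -ES.
have cT : #|adj_swap i @: S| = m by rewrite card_perm_imset.
have [le _ _] : covers_s O (wt C (adj_swap i @: S))
                  (simple_reflection i (wt C (adj_swap i @: S))).
  by apply: adj_swap_covers; rewrite ?mem_adj_lo ?mem_adj_hi // cT.
rewrite simple_reflection_wt adjK in le.
have /fle := le; rewrite f0 subset0 => /(_ (orbit_wt cT) Omu0)/eqP fT.
have : wt C (adj_swap i @: S) = wt C S.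
  by apply: fI; rewrite ?fT ?f0 //; apply: mem_set => //; apply: orbit_wt.
by move/(wt_inj (card_perm_imset _ _)) => E; rewrite -E mem_adj_lo hi in li.
Qed.

(** Induction on the moves from i to i+1: the point added to the filter has the
    color i+1, so that the row index i+1 becomes i+2, as the element i of the
    set becomes i+1. By injectivity of the row indices no other row had the
    index i+1. *)
Lemma mem_colored_iso S : #|S| = m -> forall a : 'I_n.+1,
  a \in S <-> exists l, row_index (f (wt C S)) l = a.+1.
Proof.
move=> cS; elim/adj_ind: S / cS => [|i T cT lT hT IH] a.
  rewrite colored_iso_initial inE.
  have E l : row_index (set0 : {set YT m n}) l = (m - l)%N.
    rewrite /row_index /row_len (_ : [set j | _] = set0) ?cards0; first by lia.
    by apply/setP => j; rewrite !inE.
  split=> [am|[l]]; last by rewrite E; lia.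
  have lm : (m - a.+1 < m)%N by lia.
  by exists (Ordinal lm); rewrite E /=; lia.
have cT' : #|adj_swap i @: T| = m by rewrite card_perm_imset.
have [_ fle fcov] := hf.
have cov : covers_s O (wt C T) (simple_reflection i (wt C T)).
  by apply: adj_swap_covers; rewrite // cT hk.
have [le _ _] := cov.
have [p [diff col]] := (fcov _ _ (orbit_wt cT)).1 cov.
rewrite simple_reflection_wt in le diff.
have sub := (fle _ _ (orbit_wt cT) (orbit_wt cT')).1 le.
have FT := colored_iso_filter cT; have FT' := colored_iso_filter cT'.
have idx := row_index_add_point sub diff.
have := row_index_at_point FT FT' sub diff; rewrite col => idxp.
have idxT l : row_index (f (wt C T)) l = i.+1 -> l = p.1.
  by rewrite -idxp => /(row_index_inj FT).
case: (tpermP (ord_lo i) (ord_hi i) a) => [->|->|al ah].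
- rewrite mem_adj_lo (negPf hT); split=> // -[l]; rewrite idx.
  case: eqP => [->|lp]; first by rewrite idxp addn1 /= => -[]; lia.
  by rewrite addn0 => /idxT.
- rewrite mem_adj_hi lT; split=> // _; exists p.1.
  by rewrite idx eqxx idxp addn1 /= /bump.
rewrite -{1}(tpermD (x := ord_lo i) (y := ord_hi i) (z := a)); last 2 first.
- by apply/eqP => E; apply: al.
- by apply/eqP => E; apply: ah.
rewrite mem_imset; last exact: perm_inj.
have al' : (a : nat) <> i by move=> E; apply: al; apply: val_inj.
have ah' : (a : nat) <> i.+1 by move=> E; apply: ah; apply: val_inj.
rewrite IH; split=> -[l]; rewrite ?idx => E; exists l; rewrite ?idx.
  by case: eqP => lp; rewrite ?addn0 //; move: E; rewrite lp idxp => -[]; lia.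
by case: eqP E => lp; rewrite ?addn0 // lp idxp addn1 => -[]; lia.
Qed.

End ColoredIso.

(** * Admissible sets and centrosymmetric permutations *)

Section Admissible.
Variable n : nat.
Implicit Types (a c d : 'I_n.+1) (S T : {set 'I_n.+1}) (g : {perm 'I_n.+1}).

(** In terms of signs, where rev c stands for the negative of c, an admissible
    set contains no c together with its negative; in particular it avoids the
    middle index. *)
Definition admissible S := forall c, c \in S -> rev_ord c \notin S.

Lemma rev_ord_eq c d : (rev_ord c == d) = (c == rev_ord d).
Proof. exact: (can2_eq rev_ordK rev_ordK). Qed.

Definition centrosymmetric g := forall c, g (rev_ord c) = rev_ord (g c).

Lemma admissible_imset g S :
  centrosymmetric g -> admissible S -> admissible (g @: S).
Proof.
move=> gr aS _ /imsetP[c cS ->]; rewrite -gr mem_imset; last exact: perm_inj.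
exact: aS.
Qed.

Definition flip a : {perm 'I_n.+1} := tperm a (rev_ord a).

Definition swap2 a d : {perm 'I_n.+1} :=
  (tperm a d * tperm (rev_ord a) (rev_ord d))%g.

Lemma flip_centrosymmetric a : centrosymmetric (flip a).
Proof.
move=> c; rewrite /flip; case: (tpermP a (rev_ord a) c) => [->|->|ca cr].
- by rewrite tpermR rev_ordK.
- by rewrite rev_ordK tpermL.
rewrite tpermD //; last by rewrite (inj_eq rev_ord_inj) eq_sym; apply/eqP.
by rewrite eq_sym rev_ord_eq; apply/eqP.
Qed.

Section Swap2.
Variables a d : 'I_n.+1.
Hypotheses (ar : a != rev_ord a) (dr : d != rev_ord d)
  (ard : a != rev_ord d).

Lemma rev_ord_swap : d != rev_ord a.
Proof. by rewrite eq_sym rev_ord_eq. Qed.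

Lemma swap2L : swap2 a d a = d.
Proof. by rewrite permM tpermL tpermD 1?eq_sym // rev_ord_swap. Qed.

Lemma swap2R : swap2 a d d = a.
Proof. by rewrite permM tpermR tpermD // eq_sym. Qed.

Lemma swap2D c : c != a -> c != d -> c != rev_ord a -> c != rev_ord d ->
  swap2 a d c = c.
Proof. by move=> ? ? ? ?; rewrite permM !tpermD // eq_sym. Qed.

Lemma swap2_revL : swap2 a d (rev_ord a) = rev_ord d.
Proof. by rewrite permM [tperm a d _]tpermD ?tpermL // rev_ord_swap. Qed.

Lemma swap2_revR : swap2 a d (rev_ord d) = rev_ord a.
Proof. by rewrite permM [tperm a d _]tpermD ?tpermR // rev_ord_swap. Qed.

(** Case analysis on c along the cycles of the double transposition. *)
Lemma swap2P (P : 'I_n.+1 -> 'I_n.+1 -> Prop) :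
    P a d -> P d a -> P (rev_ord a) (rev_ord d) -> P (rev_ord d) (rev_ord a) ->
    (forall c, c != a -> c != d -> c != rev_ord a -> c != rev_ord d -> P c c) ->
  forall c, P c (swap2 a d c).
Proof.
move=> Pa Pd Pra Prd P0 c.
case: (eqVneq c a) => [->|ca]; first by rewrite swap2L.
case: (eqVneq c d) => [->|cd]; first by rewrite swap2R.
case: (eqVneq c (rev_ord a)) => [->|cra]; first by rewrite swap2_revL.
case: (eqVneq c (rev_ord d)) => [->|crd]; first by rewrite swap2_revR.
by rewrite swap2D //; apply: P0.
Qed.

Lemma swap2K : involutive (swap2 a d).
Proof.
apply: (swap2P (P := fun c c' => swap2 a d c' = c)) => [||||c ????].
- exact: swap2R.
- exact: swap2L.
- exact: swap2_revR.
- exact: swap2_revL.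
exact: swap2D.
Qed.

Lemma swap2_centrosymmetric : centrosymmetric (swap2 a d).
Proof.
apply: (swap2P (P := fun c c' => swap2 a d (rev_ord c) = rev_ord c')) =>
  [||||c ca cd cra crd]; rewrite ?rev_ordK.
- exact: swap2_revL.
- exact: swap2_revR.
- exact: swap2L.
- exact: swap2R.
by rewrite swap2D // ?(inj_eq rev_ord_inj) // rev_ord_eq.
Qed.

End Swap2.

Lemma flipK a : involutive (flip a).
Proof. exact: tpermK. Qed.

(** These are the permutations induced by reflections of the folded root
    system: flips for the roots proportional to some eps a, double
    transpositions for the roots eps a - eps d. *)
Inductive generator : {perm 'I_n.+1} -> Prop :=
| generator_flip a : a != rev_ord a -> generator (flip a)
| generator_swap2 a d : a != rev_ord a -> d != rev_ord d ->
    a != d -> a != rev_ord d -> generator (swap2 a d).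

Lemma generator_centrosymmetric g : generator g -> centrosymmetric g.
Proof.
case=> [a ar|a d *]; first exact: flip_centrosymmetric.
exact: swap2_centrosymmetric.
Qed.

Lemma generatorK g : generator g -> involutive g.
Proof. by case=> [a _|a d *]; [exact: flipK|exact: swap2K]. Qed.

(** The decrease that drives admissible_ind: g moves just one element of S, and
    moves it from outside of S0 into S0. *)
Lemma card_imset_setD g S S0 a : a \in S -> a \notin S0 -> g a \in S0 ->
    (forall c, c \in S -> c != a -> g c = c) ->
  (#|(g @: S) :\: S0| < #|S :\: S0|)%N.
Proof.
move=> aS aS0 gaS0 gid; apply/proper_card/properP; split.
  apply/subsetP => _ /setDP[/imsetP[c cS ->]].
  case: (eqVneq c a) => [->|/(gid _ cS)->]; first by rewrite gaS0.
  by rewrite inE cS => ->.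
exists a; first by rewrite inE aS0.
rewrite inE aS0 /=; apply/negP => /imsetP[c cS].
case: (eqVneq c a) => [-> E|ca]; first by rewrite -E (negPf aS0) in gaS0.
by rewrite gid // => E; rewrite E eqxx in ca.
Qed.

Lemma admissible_neq S c : admissible S -> c \in S -> c != rev_ord c.
Proof. by move=> aS cS; apply: contraNneq (aS c cS) => <-. Qed.

(** The group generated by the flips and the double transpositions is
    transitive on the admissible sets of a given size. If some a in S \ S0 has
    its negative in S0, a flip moves it there. Otherwise take a in S \ S0 and d
    in S0 \ S; the negative of d is not in S, as it could be flipped, so that
    the double transposition just replaces a by d in S. *)
Lemma admissible_ind S0 (P : {set 'I_n.+1} -> Prop) :
    admissible S0 -> P S0 ->
    (forall g T, generator g -> admissible T -> P T -> P (g @: T)) ->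
  forall S, admissible S -> #|S| = #|S0| -> P S.
Proof.
move=> aS0 P0 PS S; have [s] := ubnP #|S :\: S0|.
elim: s S => // s IH S Ss aS cS.
have step g a : generator g -> a \in S -> a \notin S0 -> g a \in S0 ->
    (forall c, c \in S -> c != a -> g c = c) -> P S.
  move=> Gg aiS aS0' gaS0 gid.
  have -> : S = g @: (g @: S).
    rewrite -imset_comp (eq_imset (g := id)) ?imset_id // => c /=.
    exact: generatorK.
  have agS := admissible_imset (generator_centrosymmetric Gg) aS.
  apply: PS => //; apply: IH; rewrite ?card_perm_imset //.
  rewrite -ltnS; apply: leq_trans Ss; rewrite ltnS.
  exact: (card_imset_setD (a := a)).
case: (set_0Vmem (S :\: S0)) => [/eqP|[a /setDP[aiS aS0']]].
  rewrite setD_eq0 => SS0; suff -> : S = S0 by [].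
  by apply/eqP; rewrite eqEcard SS0 cS leqnn.
have flip_step a' : a' \in S -> a' \notin S0 -> rev_ord a' \in S0 -> P S.
  move=> a'S a'S0 ra'; apply: (step (flip a') a') => //.
  - exact/generator_flip/(admissible_neq aS).
  - by rewrite /flip tpermL.
  move=> c cS' ca; rewrite /flip tpermD 1?eq_sym //.
  by apply: contraTneq cS' => ->; exact: aS.
case: (boolP (rev_ord a \in S0)) => [|raS0]; first exact: flip_step.
have /subsetPn[d dS0 dS] : ~~ (S0 \subset S).
  apply: contra aS0' => S0S; suff -> : S0 = S by [].
  by apply/eqP; rewrite eqEcard S0S cS leqnn.
case: (boolP (rev_ord d \in S)) => [rdS|rdS].
  by apply: (flip_step (rev_ord d)); rewrite ?rev_ordK // aS0.
have ad : a != d by apply: contraTneq aiS => ->.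
have ard : a != rev_ord d by apply: contraTneq aiS => ->.
have ar := admissible_neq aS aiS; have dr := admissible_neq aS0 dS0.
apply: (step (swap2 a d) a) => //; first exact: generator_swap2.
  by rewrite swap2L.
move=> c cS' ca; rewrite swap2D //; apply: contraTneq cS' => ->//.
exact: aS.
Qed.

End Admissible.

(** * The filters of SS *)

Section SS.
Variables (C : numFieldType) (m n : nat) (k : 'I_n) (hk : k.+1 = m).
Variable f : dual C 'rV[C]_n -> {set YT m n}.
Hypothesis hf :
  is_colored_iso (orbit_of (@weyl_A C n) (fundamental_weight C k)) f.

Lemma SS_admissible (S : {set 'I_n.+1}) :
  #|S| = m -> @SS m n (f (wt C S)) <-> admissible S.
Proof.
move=> cS; have FS := colored_iso_filter hk hf cS.
have mem := mem_colored_iso hk hf cS; split.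
  case=> _ disj c cinS; apply/negP => rcS.
  have [l lc] := (mem c).1 cinS; have [l' lc'] := (mem _).1 rcS.
  suff : (I_set (f (wt C S)) `&` I_bar (f (wt C S)))%classic c.+1.
    by rewrite disj.
  split; first by exists l.
  exists (row_index (f (wt C S)) l'); first by exists l'.
  by rewrite lc' /=; have := ltn_ord c; lia.
move=> aS; split=> //; rewrite -classical_sets.subset0 => _
  [[l _ <-] [_ [l' _ <-]]].
rewrite -!/(row_index _ _) => E.
have mn : (m <= n)%N by rewrite -hk ltn_ord.
have le x : (0 < row_index (f (wt C S)) x <= n.+1)%N.
  have : (row_len (f (wt C S)) x <= (n - m).+1)%N.
    by rewrite -[X in (_ <= X)%N]card_ord max_card.
  by rewrite /row_index; have := ltn_ord x; lia.
have /andP[l0 ln] := le l; have /andP[l0' ln'] := le l'.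
have cn : ((row_index (f (wt C S)) l).-1 < n.+1)%N by lia.
have : Ordinal cn \in S by apply/mem; exists l; rewrite /= prednK.
move=> cinS; have /negP := aS _ cinS; case; apply/mem; exists l'.
by rewrite /=; lia.
Qed.

End SS.

(** * The subgroup of W that commutes with sigma *)

Section SigmaDual.
Variables (C : numFieldType) (n : nat).
Implicit Types (a c d : 'I_n.+1) (h : 'rV[C]_n) (mu : dual C 'rV[C]_n).
Local Notation eps := (@eps C n).

Lemma eps_sigma c h : eps c (sigma_h C n h) = - eps (rev_ord c) h :> C.
Proof.
rewrite !eps_coord -sumrN (reindex_inj rev_ord_inj) /=; apply: eq_bigr => j _.
rewrite lfunE mxE rev_ordK -rev_ord_lo -rev_ord_hi !rev_ord_eq.
by rewrite -mulNr opprB.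
Qed.

Lemma sigma_hK : involutive (sigma_h C n).
Proof. by move=> h; rewrite !lfunE; apply/rowP => j; rewrite !mxE rev_ordK. Qed.

Lemma sigma_dualE mu h : sigma_dual mu h = mu (sigma_h C n h).
Proof.
rewrite comp_lfunE -{1}[h]sigma_hK lker0_lfunK //.
by apply/lker0P; exact: inv_inj sigma_hK.
Qed.

Lemma sigma_dual_eps c : sigma_dual (eps c) = - eps (rev_ord c).
Proof. by apply/lfunP => h; rewrite sigma_dualE opp_lfunE eps_sigma. Qed.

Lemma sigma_dual_linear : linear (@sigma_dual C n).
Proof. by move=> a u v; rewrite /sigma_dual comp_lfunDl comp_lfunZl. Qed.

Lemma linear_eq_eps (w1 w2 : dual C 'rV[C]_n -> dual C 'rV[C]_n) :
  linear w1 -> linear w2 -> (forall c, w1 (eps c) = w2 (eps c)) -> w1 =1 w2.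
Proof.
move=> L1 L2 E mu.
pose W1 : {linear dual C 'rV[C]_n -> dual C 'rV[C]_n} :=
  HB.pack w1 (GRing.isLinear.Build C _ _ _ w1 L1).
pose W2 : {linear dual C 'rV[C]_n -> dual C 'rV[C]_n} :=
  HB.pack w2 (GRing.isLinear.Build C _ _ _ w2 L2).
have -> : mu = \sum_j (mu (simple_coroot C j) : C) *: fundamental_weight C j.
  apply: dual_ext => i; rewrite sum_lfunE (bigD1 i) //= big1 => [|j ji].
    by rewrite scale_lfunE fundamental_weightE eqxx addr0 [_ *: _]mulr1.
  by rewrite scale_lfunE fundamental_weightE (negPf ji) scaler0.
rewrite -[w1 _]/(W1 _) -[w2 _]/(W2 _) !linear_sum; apply: eq_bigr => j _.
rewrite !linearZ fundamental_weight_wt /=; congr (_ *: _).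
rewrite -[w1 _]/(W1 _) -[w2 _]/(W2 _) !linear_sum; apply: eq_bigr => c _.
exact: E.
Qed.

(** Since sigma sends eps c to - eps (rev c), commuting with sigma amounts to
    permuting the indices in a way that commutes with rev. *)
Lemma weyl_hat_of_centrosymmetric w g :
  weyl_A w -> acts_by eps w g -> centrosymmetric g -> weyl_hat w.
Proof.
move=> Ww [Lw Ew] gr; split=> //; apply: linear_eq_eps => [a u v|a u v|c] /=.
- by rewrite Lw sigma_dual_linear.
- by rewrite sigma_dual_linear Lw.
have w0 : w 0 = 0 by have := Lw (-1) 0 0; rewrite scaler0 addr0 scaleN1r addNr.
have wN u : w (- u) = - w u.
  by have := Lw (-1) u 0; rewrite w0 !addr0 !scaleN1r.
by rewrite Ew !sigma_dual_eps wN Ew gr.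
Qed.

End SigmaDual.

(** * The reflections of the fixed-point subalgebra *)

Section FoldedCartan.
Variables (C : numFieldType) (n : nat).
Implicit Types (a c d : 'I_n.+1) (h : 'rV[C]_n) (mu : dual C 'rV[C]_n)
  (v : 'I_n.+1 -> C) (u : subvs_of (h0 C n)) (z : 'M[C]_n.+1).
Local Notation eps := (@eps C n).

Definition epsb c : dual C (subvs_of (h0 C n)) := res (eps c).

Lemma resE mu u : res mu u = mu (vsval u).
Proof. by rewrite comp_lfunE lfunE. Qed.

Lemma epsb_rev c : epsb (rev_ord c) = - epsb c.
Proof.
apply/lfunP => u; rewrite opp_lfunE !resE.
have /fixedSpaceP {1}<- : vsval u \in h0 C n := subvsP u.
by rewrite eps_sigma rev_ordK.
Qed.

Lemma res_wt (S : {set 'I_n.+1}) : res (wt C S) = \sum_(c in S) epsb c.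
Proof.
apply/lfunP => u; rewrite resE !sum_lfunE.
by apply: eq_bigr => c _; rewrite resE.
Qed.

Definition h0_vec v : subvs_of (h0 C n) := vsproj (h0 C n) (cochar v).

Lemma epsb_h0_vec v : (forall c, v (rev_ord c) = - v c) ->
  forall c, epsb c (h0_vec v) = v c :> C.
Proof.
move=> vN c; have v0 := antisym_sum vN.
rewrite resE vsprojK ?eps_cochar //; apply/fixedSpaceP.
by apply: row_eq_eps => d; rewrite eps_sigma !eps_cochar // vN opprK.
Qed.

(** h0_vec (sgnd a) is the diagonal matrix E_aa - E_{rev a, rev a}, which plays
    the role of the a-th coordinate vector of h0; it is 0 when a is the middle
    index. *)
Definition sgnd a c : C := (c == a)%:R - (c == rev_ord a)%:R.

Lemma sgnd_rev a c : sgnd a (rev_ord c) = - sgnd a c.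
Proof. by rewrite /sgnd !rev_ord_eq rev_ordK opprB. Qed.

Lemma epsb_sgnd a c : epsb c (h0_vec (sgnd a)) = sgnd a c :> C.
Proof. exact/epsb_h0_vec/sgnd_rev. Qed.

Lemma sgnd_id a : a != rev_ord a -> sgnd a a = 1.
Proof. by move=> ar; rewrite /sgnd eqxx (negPf ar) subr0. Qed.

Lemma sgnd_eq0 a c : c != a -> c != rev_ord a -> sgnd a c = 0.
Proof. by move=> ca cr; rewrite /sgnd (negPf ca) (negPf cr) subr0. Qed.

Lemma sgnd_eq1 a c : sgnd a c = 1 -> c = a.
Proof.
rewrite /sgnd; case: (eqVneq c a) => // ca; case: eqP => _ /= /eqP.
  by rewrite sub0r eq_sym -addr_eq0 -(natrD _ 1 1) pnatr_eq0.
by rewrite subrr eq_sym oner_eq0.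
Qed.

Lemma sgnd_neq2 a c : sgnd a c != 2.
Proof.
rewrite /sgnd.
case: (c == a); case: (c == rev_ord a) => /=.
- by rewrite subrr eq_sym pnatr_eq0.
- by rewrite subr0 eqr_nat.
- by rewrite sub0r eq_sym -addr_eq0 -(natrD _ 2 1) pnatr_eq0.
- by rewrite subrr eq_sym pnatr_eq0.
Qed.

Lemma epsb_center a : a == rev_ord a -> epsb a = 0.
Proof.
move=> /eqP aE; apply/eqP; have := epsb_rev a; rewrite -aE => /eqP.
by rewrite -addr_eq0 -mulr2n -scaler_nat scaler_eq0 pnatr_eq0.
Qed.

(** The hypothesis covers the roots 2 eps a, eps a and - eps a, with coroots of
    the corresponding lengths. *)
Lemma flip_acts_by a beta b : a != rev_ord a ->
    (forall c, (epsb c b : C) *: beta = (2 * sgnd a c) *: epsb a) ->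
  acts_by epsb (reflection beta b) (flip a).
Proof.
move=> ar E; apply: reflection_acts_by => c; rewrite E.
rewrite /flip; case: tpermP => [->|->|/eqP ca /eqP cr].
- by rewrite sgnd_id // epsb_rev mulr1 scaler_nat mulr2n opprD addNKr.
- rewrite sgnd_rev sgnd_id // epsb_rev mulrN1 scaleNr opprK.
  by rewrite scaler_nat mulr2n addKr.
- by rewrite sgnd_eq0 // mulr0 scale0r subr0.
Qed.

Lemma swap2_acts_by a d b : a != rev_ord a -> d != rev_ord d ->
    a != d -> a != rev_ord d ->
    (forall c, epsb c b = sgnd a c - sgnd d c :> C) ->
  acts_by epsb (reflection (epsb a - epsb d) b) (swap2 a d).
Proof.
move=> ar dr ad ard E; apply: reflection_acts_by => c; rewrite E.
have da : d != a by rewrite eq_sym.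
have dra : d != rev_ord a by rewrite rev_ord_swap.
move: c; apply: (swap2P ar dr ard (P := fun c c' =>
  epsb c - (sgnd a c - sgnd d c) *: (epsb a - epsb d) = epsb c')).
- by rewrite sgnd_id // sgnd_eq0 // subr0 scale1r subKr.
- by rewrite sgnd_id // sgnd_eq0 // sub0r scaleN1r opprK addrC subrK.
- rewrite !sgnd_rev sgnd_id // sgnd_eq0 // oppr0 subr0 scaleN1r !epsb_rev.
  by rewrite opprK addKr.
- rewrite !sgnd_rev sgnd_id // sgnd_eq0 // oppr0 sub0r opprK scale1r !epsb_rev.
  by rewrite opprB addKr.
move=> c ca cd cra crd.
by rewrite !sgnd_eq0 // subrr scale0r subr0.
Qed.

Section Reflections.
Variables (beta : dual C (subvs_of (h0 C n))) (b : subvs_of (h0 C n)).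

Lemma root_space_entry gamma z c e :
  root_space (@fixed_sl C n) (@h0_emb C n) gamma z -> z c e != 0 ->
  gamma = epsb c - epsb e.
Proof.
move=> [_ E] zce; apply/lfunP => u; rewrite add_lfunE opp_lfunE !resE.
apply: (mulIf zce); have := congr1 (fun M : 'M[C]_n.+1 => M c e) (E u).
by rewrite bracket_cartan mxE.
Qed.

(** The values of a coroot are the diagonal entries of a bracket [x, y] with x
    in the root space of beta and y in that of - beta. A nonzero entry (c, e) of
    x forces eps c - eps e to restrict to beta, and evaluating this relation on
    the coordinate vectors of h0 leaves few entries. In the generic case the
    entries of x and y in rows a and d are x_ad and y_da only, so that the
    values at a and d are x_ad y_da and its opposite. *)
Lemma coroot_cases x y a d :
    root_space (@fixed_sl C n) (@h0_emb C n) beta x ->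
    root_space (@fixed_sl C n) (@h0_emb C n) (- beta) y ->
    bracket x y = h0_emb b -> beta != 0 -> beta = epsb a - epsb d ->
    (forall c, c != a -> c != d -> c != rev_ord a -> c != rev_ord d ->
       epsb c b = 0 :> C) /\
    (a != rev_ord a -> d != rev_ord d -> a != d -> a != rev_ord d ->
       epsb d b = - epsb a b :> C).
Proof.
move=> rx ry xy b0 bE.
have bc c : epsb c b = \sum_e (x c e * y e c - y c e * x e c) :> C.
  have := congr1 (fun M : 'M[C]_n.+1 => M c c) xy.
  rewrite cartan_embE eqxx mulr1n resE => <-.
  by rewrite !mxE -sumrB.
have rxE c e : x c e != 0 -> epsb c - epsb e = epsb a - epsb d.
  by move=> /(root_space_entry rx) <-.
have ryE c e : y c e != 0 -> epsb e - epsb c = epsb a - epsb d.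
  by move=> /(root_space_entry ry) E; rewrite -bE -[beta]opprK E opprB.
have ev s t p q : epsb s - epsb t = epsb p - epsb q ->
    forall o, sgnd o s - sgnd o t = sgnd o p - sgnd o q.
  move=> E o; move: E.
  move/(congr1
    (fun mu : dual C (subvs_of (h0 C n)) => mu (h0_vec (sgnd o)) : C)).
  by rewrite !add_lfunE !opp_lfunE !epsb_sgnd.
split=> [c ca cd cra crd|ar dr ad ard].
  case: (boolP (c == rev_ord c)) => [/epsb_center->|cr].
    by rewrite zero_lfunE.
  rewrite bc big1 // => e _.
  have one : sgnd c a = 0 by rewrite sgnd_eq0 // eq_sym // rev_ord_eq.
  have two : sgnd c d = 0 by rewrite sgnd_eq0 // eq_sym // rev_ord_eq.
  have -> : x c e = 0.
    apply/eqP/negPn/negP => /rxE E; move: (ev _ _ _ _ E c).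
    rewrite one two sgnd_id // subrr => /eqP; rewrite subr_eq0 eq_sym => /eqP.
    by move/sgnd_eq1 => ec; move/eqP: b0; rewrite bE -E ec subrr.
  have -> : y c e = 0.
    apply/eqP/negPn/negP => /ryE E; move: (ev _ _ _ _ E c).
    rewrite one two sgnd_id // subrr => /eqP; rewrite subr_eq0 => /eqP.
    by move/sgnd_eq1 => ec; move/eqP: b0; rewrite bE -E ec subrr.
  by rewrite !mul0r subrr.
have da : d != a by rewrite eq_sym.
have dra : d != rev_ord a by rewrite rev_ord_swap.
have xae e : e != d -> x a e = 0.
  move=> ed; apply/eqP/negPn/negP => /rxE/ev/(_ d).
  rewrite (sgnd_eq0 ad) // (sgnd_id dr) => /addrI/oppr_inj/sgnd_eq1 E.
  by rewrite E eqxx in ed.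
have yae e : y a e = 0.
  apply/eqP/negPn/negP => /ryE/ev/(_ a).
  rewrite (sgnd_eq0 da) // (sgnd_id ar) subr0 => /eqP.
  by rewrite subr_eq (negPf (sgnd_neq2 _ _)).
have yde e : e != a -> y d e = 0.
  move=> ea; apply/eqP/negPn/negP => /ryE/ev/(_ a).
  rewrite (sgnd_eq0 da) // (sgnd_id ar) => /addIr/sgnd_eq1 E.
  by rewrite E eqxx in ea.
have xde e : x d e = 0.
  apply/eqP/negPn/negP => /rxE/ev/(_ d).
  rewrite (sgnd_eq0 ad) // (sgnd_id dr) sub0r => /eqP.
  rewrite subr_eq addrC -subr_eq opprK eq_sym -(natrD _ 1 1).
  by rewrite (negPf (sgnd_neq2 _ _)).
rewrite !bc (bigD1 a) //= big1 => [|e ea]; last first.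
  by rewrite xde yde // !mul0r subrr.
rewrite (bigD1 d) //= big1 => [|e ed]; last by rewrite xae // yae !mul0r subrr.
by rewrite xde yae !mul0r !addr0 sub0r subr0 mulrC.
Qed.

(** If x is a nonzero root vector with a nonzero entry (a, d), then beta is the
    restriction of eps a - eps d. Unless a, d and their negatives are four
    different indices, beta is proportional to one eps s and the reflection is
    a flip; in the remaining case it is a double transposition. Each time
    beta(b) = 2 fixes the values of the coroot b. *)
Lemma folded_reflection_acts_by :
    is_root (@fixed_sl C n) (@h0_emb C n) beta ->
    is_coroot (@fixed_sl C n) (@h0_emb C n) beta b ->
  exists2 g, centrosymmetric g & acts_by epsb (reflection beta b) g.
Proof.
move=> [b0 [z rz z0]] [[x [y [rx ry xy]]] bb].
have [a [d zad]] : exists a d, z a d != 0.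
  have [|/forallPn[a /forallPn[d zad]]] :=
    boolP [forall a, forall d, z a d == 0].
    move=> /forallP E; case/eqP: z0; apply/matrixP => a d.
    by rewrite mxE; apply/eqP; move: d; apply/forallP.
  by exists a, d.
have bE := root_space_entry rz zad.
have [supp opp] := coroot_cases rx ry xy b0 bE.
have revb c : epsb (rev_ord c) b = - epsb c b :> C.
  by rewrite epsb_rev opp_lfunE.
have cen c : c == rev_ord c -> epsb c b = 0 :> C.
  by move/epsb_center->; rewrite zero_lfunE.
have bb' : (epsb a b : C) - epsb d b = 2.
  by rewrite -bb bE add_lfunE opp_lfunE.
have ad : a != d by apply: contraNneq b0 => ad; rewrite bE ad subrr.
have flipE s : s != rev_ord s ->
    (forall c, c != s -> c != rev_ord s -> epsb c b = 0 :> C) ->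
    (epsb s b : C) *: beta = 2 *: epsb s ->
    exists2 g, centrosymmetric g & acts_by epsb (reflection beta b) g.
  move=> sr s0 sE; exists (flip s); first exact: flip_centrosymmetric.
  apply: flip_acts_by => // c.
  case: (eqVneq c s) => [->|cs]; first by rewrite sgnd_id // mulr1.
  case: (eqVneq c (rev_ord s)) => [->|csr].
    by rewrite revb sgnd_rev sgnd_id // mulrN1 !scaleNr sE.
  by rewrite s0 // sgnd_eq0 // mulr0 !scale0r.
case: (boolP (a == rev_ord a)) => [ac|ar].
  have a0 := epsb_center ac; rewrite a0 sub0r in bE.
  have db : epsb d b = -2 :> C by rewrite -bb' (cen a ac) sub0r opprK.
  apply: (flipE d) => [|c cd cdr|].
  - by apply: contraNneq b0 => dc; rewrite bE epsb_center ?oppr0 -?dc.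
  - case: (eqVneq c a) => [->|ca]; first exact: cen.
    by apply: supp; rewrite // -(eqP ac).
  - by rewrite db bE scaleNr scalerN opprK.
case: (boolP (d == rev_ord d)) => [dc|dr].
  have d0 := epsb_center dc; rewrite d0 subr0 in bE.
  have ab : epsb a b = 2 :> C by rewrite -bb' (cen d dc) subr0.
  apply: (flipE a) => // [c ca car|]; last by rewrite ab bE.
  case: (eqVneq c d) => [->|cd]; first exact: cen.
  by apply: supp; rewrite // -(eqP dc).
case: (eqVneq a (rev_ord d)) => [ard|ard].
  have dE : d = rev_ord a by rewrite ard rev_ordK.
  have ab : epsb a b = 1 :> C.
    apply: (mulfI (_ : 2 != 0)); first by rewrite pnatr_eq0.
    by rewrite mulr1 mulr_natl mulr2n -bb' dE revb opprK.
  apply: (flipE a) => // [c ca car|].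
    by apply: supp; rewrite // ?dE // rev_ordK.
  by rewrite ab scale1r bE dE epsb_rev opprK scaler_nat mulr2n.
exists (swap2 a d); first exact: swap2_centrosymmetric.
rewrite bE; apply: swap2_acts_by => //.
have dE := opp ar dr ad ard.
have ab : epsb a b = 1 :> C.
  apply: (mulfI (_ : 2 != 0)); first by rewrite pnatr_eq0.
  by rewrite mulr1 mulr_natl mulr2n -bb' dE opprK.
have dra : d != rev_ord a by rewrite rev_ord_swap.
have da : d != a by rewrite eq_sym.
move=> c.
case: (eqVneq c a) => [->|ca].
  by rewrite sgnd_id // sgnd_eq0 // subr0.
case: (eqVneq c d) => [->|cd].
  by rewrite sgnd_id // sgnd_eq0 // sub0r dE ab.
case: (eqVneq c (rev_ord a)) => [->|cra].
  by rewrite !sgnd_rev sgnd_id // sgnd_eq0 // oppr0 subr0 revb ab.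
case: (eqVneq c (rev_ord d)) => [->|crd].
  rewrite !sgnd_rev sgnd_id // sgnd_eq0 // oppr0 sub0r opprK revb dE ab.
  by rewrite opprK.
by rewrite supp // !sgnd_eq0 // subrr.
Qed.

End Reflections.

Lemma weyl_tilde_acts_by
    (w : dual C (subvs_of (h0 C n)) -> dual C (subvs_of (h0 C n))) :
  weyl_tilde w -> exists2 g, centrosymmetric g & acts_by epsb w g.
Proof.
elim=> [|s w' [beta [b [rb cb ->]]] _ [g gr wg]].
  by exists 1%g; [move=> c; rewrite !perm1|exact: acts_by_id].
have [g' g'r sg'] := folded_reflection_acts_by rb cb.
exists (g * g')%g; last exact: acts_by_comp.
by move=> c; rewrite !permM gr g'r.
Qed.

End FoldedCartan.

(** * Root vectors of the fixed-point subalgebra *)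

Section FoldedRootVectors.
Variables (C : numFieldType) (n : nat).
Implicit Types (a c d : 'I_n.+1) (u : subvs_of (h0 C n)) (x y z : 'M[C]_n.+1).
Local Notation epsb := (@epsb C n).
Local Notation root_space := (root_space (@fixed_sl C n) (@h0_emb C n)).

Lemma bracketDr x y z : bracket x (y + z) = bracket x y + bracket x z.
Proof. by rewrite /bracket mulmxDr mulmxDl opprD addrACA. Qed.

Lemma bracketDl x y z : bracket (x + y) z = bracket x z + bracket y z.
Proof. by rewrite /bracket mulmxDr mulmxDl opprD addrACA. Qed.

Lemma bracketZr (k : C) x y : bracket x (k *: y) = k *: bracket x y.
Proof. by rewrite /bracket -scalemxAr -scalemxAl scalerBr. Qed.

Lemma sigma_gl_h0 u : sigma_gl (h0_emb u) = h0_emb u.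
Proof.
rewrite /h0_emb sigma_gl_h.
by have /fixedSpaceP-> : vsval u \in h0 C n := subvsP u.
Qed.

Lemma root_spaceZ (k : C) beta x :
  root_space beta x -> root_space beta (k *: x).
Proof.
move=> [[slx sx] E]; split=> [|u]; last by rewrite bracketZr E !scalerA mulrC.
by split; [rewrite /sl /= mxtraceZ slx mulr0|rewrite linearZ /= sx].
Qed.

Definition folded_delta a d : 'M[C]_n.+1 :=
  delta_mx a d + sigma_gl (delta_mx a d).

Lemma folded_delta_root a d : a != d ->
  root_space (epsb a - epsb d) (folded_delta a d).
Proof.
move=> ad; split=> [|u].
  split; last by rewrite /folded_delta linearD /= sigma_glK addrC.
  have sl0 : \tr (delta_mx a d : 'M[C]_n.+1) = 0 := sl_delta C ad.
  rewrite /sl /= /folded_delta linearD /= sl0 add0r sigma_gl_delta.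
  rewrite linearN linearZ /= (_ : \tr _ = 0) ?mulr0 ?oppr0 //.
  by apply: sl_delta; rewrite (inj_eq rev_ord_inj) eq_sym.
have E : bracket (h0_emb u) (delta_mx a d) =
         ((epsb a - epsb d) u : C) *: delta_mx a d.
  by rewrite bracket_cartan_delta add_lfunE opp_lfunE !resE.
rewrite /folded_delta bracketDr scalerDr E; congr (_ + _).
by rewrite -{1}[h0_emb u]sigma_gl_h0 -sigma_gl_bracket E linearZ.
Qed.

Lemma sigma_gl_delta_diag a : sigma_gl (delta_mx a a : 'M[C]_n.+1) =
  - delta_mx (rev_ord a) (rev_ord a).
Proof.
by rewrite sigma_gl_delta addnn -mul2n exprM sqrrN !expr1n scale1r.
Qed.

Lemma h0_emb_diag u : h0_emb u = \sum_c (epsb c u : C) *: delta_mx c c.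
Proof.
apply/matrixP => i j; rewrite cartan_embE summxE (bigD1 i) //= big1 => [|c ci].
  rewrite !mxE eqxx addr0 /= resE [j == i]eq_sym.
  by case: (i == j); rewrite ?mulr1 ?mulr0.
by rewrite !mxE [i == c]eq_sym (negPf ci) mulr0.
Qed.

Lemma sum_indic_delta a :
  \sum_c ((c == a)%:R : C) *: delta_mx c c = delta_mx a a :> 'M[C]_n.+1.
Proof.
rewrite (bigD1 a) //= eqxx scale1r big1 ?addr0 // => c /negPf->.
exact: scale0r.
Qed.

Lemma sum_sgnd_delta a : \sum_c sgnd C a c *: delta_mx c c =
  delta_mx a a - delta_mx (rev_ord a) (rev_ord a) :> 'M[C]_n.+1.
Proof.
rewrite -!sum_indic_delta -sumrB.
by apply: eq_bigr => c _; rewrite -scalerBl.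
Qed.

(** The mixed brackets vanish, and the two others are E_aa - E_dd and its image
    under sigma_gl. *)
Lemma bracket_folded_delta a d : d != rev_ord a ->
  bracket (folded_delta a d) (folded_delta d a) =
  \sum_c (sgnd C a c - sgnd C d c) *: delta_mx c c.
Proof.
move=> dra; rewrite /folded_delta bracketDl !bracketDr -sigma_gl_bracket.
have E : bracket (delta_mx a d) (sigma_gl (delta_mx d a)) = 0 :> 'M[C]_n.+1.
  rewrite sigma_gl_delta -scaleN1r scalerA bracketZr /bracket.
  rewrite !mul_delta_mx_cond (negPf dra) rev_ord_eq (negPf dra) !mulr0n subrr.
  exact: scaler0.
have E' : bracket (sigma_gl (delta_mx a d)) (delta_mx d a) = 0 :> 'M[C]_n.+1.
  by rewrite -[delta_mx d a]sigma_glK -sigma_gl_bracket E linear0.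
rewrite E E' addr0 add0r bracket_delta linearB /= !sigma_gl_delta_diag.
under eq_bigr do rewrite scalerBl.
by rewrite sumrB !sum_sgnd_delta addrACA opprB opprK [- _ + _]addrC.
Qed.

Definition tilde_perm (g : {perm 'I_n.+1}) :=
  exists2 w, @weyl_tilde C n w & acts_by epsb w g.

(** The factor k normalises the bracket of the two root vectors to a coroot. *)
Lemma tilde_perm_reflection (k : C) a d b g : a != d ->
    k *: bracket (folded_delta a d) (folded_delta d a) = h0_emb b ->
    (epsb a - epsb d) b = 2 :> C ->
    acts_by epsb (reflection (epsb a - epsb d) b) g ->
  tilde_perm g.
Proof.
move=> ad kE b2 gE; exists (reflection (epsb a - epsb d) b) => //.
apply: (@generated_comp _ _ (reflection (epsb a - epsb d) b) id);
  last exact: generated_id.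
have rx := folded_delta_root ad.
have ry : root_space (- (epsb a - epsb d)) (folded_delta d a).
  by rewrite opprB; apply: folded_delta_root; rewrite eq_sym.
exists (epsb a - epsb d), b; split=> //; last first.
  split=> //; exists (folded_delta a d), (k *: folded_delta d a).
  by rewrite bracketZr; split=> //; exact: root_spaceZ.
split.
  apply/eqP => E; move/eqP: b2.
  by rewrite E zero_lfunE eq_sym pnatr_eq0.
exists (folded_delta a d) => //; apply/eqP => E.
have b0 c : epsb c b = 0 :> C.
  have := congr1 (fun M : 'M[C]_n.+1 => M c c) kE.
  rewrite cartan_embE eqxx mulr1n resE => <-.
  by rewrite E /bracket mul0mx mulmx0 subrr scaler0 mxE.
by move/eqP: b2; rewrite add_lfunE opp_lfunE !b0 subrr eq_sym pnatr_eq0.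
Qed.

Lemma sigma_gl_antidiag a : odd n ->
  sigma_gl (delta_mx a (rev_ord a)) = delta_mx a (rev_ord a) :> 'M[C]_n.+1.
Proof.
move=> on; rewrite sigma_gl_delta rev_ordK /= subSS subnK ?leq_ord //.
by rewrite -signr_odd on expr1 scaleN1r opprK.
Qed.

(** For odd n the antidiagonal elementary matrices are fixed by sigma_gl and
    carry the root 2 eps a. For even n sigma_gl negates them, but there is a
    middle index d, for which eps d vanishes on h0, and the root used is
    eps a - eps d = eps a. *)
Lemma tilde_perm_flip a : a != rev_ord a -> tilde_perm (flip a).
Proof.
move=> ar; case: (boolP (odd n)) => [on|en].
  pose b := h0_vec (sgnd C a).
  (* The folded matrices are twice elementary ones, whence the factor 1/4. *)
  apply: (@tilde_perm_reflection 4^-1 a (rev_ord a) b) => //.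
  - have E c : c != rev_ord c ->
        folded_delta c (rev_ord c) = 2 *: delta_mx c (rev_ord c).
      by rewrite /folded_delta sigma_gl_antidiag // scaler_nat mulr2n.
    have Er : folded_delta (rev_ord a) a = 2 *: delta_mx (rev_ord a) a.
      by have := E (rev_ord a); rewrite rev_ordK eq_sym; apply.
    rewrite E // Er bracketZr /bracket -scalemxAl -scalemxAr -scalerBr.
    rewrite -/(bracket _ _) bracket_delta !scalerA h0_emb_diag.
    rewrite (_ : 4^-1 * 2 * 2 = 1) ?scale1r; last by field.
    by rewrite -sum_sgnd_delta; apply: eq_bigr => c _; rewrite epsb_sgnd.
  - rewrite add_lfunE opp_lfunE !epsb_sgnd sgnd_rev sgnd_id // opprK.
    by rewrite -(natrD _ 1 1).
  apply: flip_acts_by => // c; rewrite epsb_sgnd epsb_rev opprK -mulr2n.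
  by rewrite -scaler_nat scalerA mulrC.
have cn : (n./2 < n.+1)%N by lia.
pose d := Ordinal cn.
have dr : d = rev_ord d.
  by apply: val_inj; rewrite /= subSS; move: (odd_double_half n); lia.
have ad : a != d by apply: contraNneq ar => ->; rewrite -dr.
have s0 c : sgnd C d c = 0 by rewrite /sgnd -dr subrr.
pose v c := 2 * sgnd C a c.
have bE c : epsb c (h0_vec v) = v c :> C.
  by apply: epsb_h0_vec => e; rewrite /v sgnd_rev mulrN.
(* The middle entries cancel in the bracket, which is half the coroot. *)
apply: (@tilde_perm_reflection 2 a d (h0_vec v)) => //.
- rewrite bracket_folded_delta // ?h0_emb_diag; last first.
    by rewrite eq_sym rev_ord_eq -dr.
  rewrite scaler_sumr; apply: eq_bigr => c _.
  by rewrite bE s0 subr0 scalerA.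
- have da0 : sgnd C a d = 0.
    rewrite /sgnd eq_sym (negPf ad) {1}dr rev_ord_eq rev_ordK eq_sym (negPf ad).
    exact: subrr.
  by rewrite add_lfunE opp_lfunE !bE /v sgnd_id // da0 mulr0 subr0 mulr1.
apply: flip_acts_by => // c.
by rewrite bE [epsb d]epsb_center ?subr0 //; apply/eqP.
Qed.

Lemma tilde_perm_swap2 a d : a != rev_ord a -> d != rev_ord d ->
  a != d -> a != rev_ord d -> tilde_perm (swap2 a d).
Proof.
move=> ar dr ad ard; pose v c := sgnd C a c - sgnd C d c.
have dra : d != rev_ord a by rewrite rev_ord_swap.
have da : d != a by rewrite eq_sym.
have bE c : epsb c (h0_vec v) = v c :> C.
  by apply: epsb_h0_vec => e; rewrite /v !sgnd_rev opprK [RHS]opprB addrC.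
apply: (@tilde_perm_reflection 1 a d (h0_vec v)) => //.
- rewrite scale1r bracket_folded_delta // h0_emb_diag.
  by apply: eq_bigr => c _; rewrite bE.
- rewrite add_lfunE opp_lfunE !bE /v !sgnd_id // !sgnd_eq0 //.
  by rewrite subr0 sub0r opprK -(natrD _ 1 1).
exact: swap2_acts_by.
Qed.

Lemma tilde_perm_generator g : generator g -> tilde_perm g.
Proof. by case=> [a|a d]; [exact: tilde_perm_flip|exact: tilde_perm_swap2]. Qed.

Lemma tilde_permM g g' :
  tilde_perm g -> tilde_perm g' -> tilde_perm (g * g')%g.
Proof.
move=> [w Ww wg] [w' Ww' wg']; exists (w' \o w); last exact: acts_by_comp.
by elim: Ww' => [//|s w2 Ss _ IH]; exact: (generated_comp Ss IH).
Qed.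

End FoldedRootVectors.

(** * Comparison of the two families *)

Section Folding.
Variables (C : numFieldType) (m n : nat) (hm : (2 * m <= n + 1)%N)
  (k : 'I_n) (hk : k.+1 = m).
Implicit Types (S T : {set 'I_n.+1}) (g : {perm 'I_n.+1}).
Local Notation lambda := (fundamental_weight C k).

Lemma initial_admissible : admissible (initial n m).
Proof. by move=> c; rewrite !inE /= => cm; lia. Qed.

Lemma weyl_perm_generator g : generator g -> weyl_perm C g.
Proof.
case=> [a _|a d _ _ _ _]; first exact: weyl_perm_tperm.
by apply: weyl_permM; exact: weyl_perm_tperm.
Qed.

(** Each generator of admissible_ind lifts to both groups, with the same
    permutation. *)
Lemma hat_orbit_admissible S : admissible S -> #|S| = m ->
  orbit_of (@weyl_hat C n) lambda (wt C S) /\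
  orbit_of (@weyl_tilde C n) (res lambda) (res (wt C S)).
Proof.
have c0 : #|initial n m| = m.
  by apply: card_initial; rewrite -hk ltnW // ltnS ltn_ord.
rewrite fundamental_weight_wt hk -/(initial n m) => aS cS.
have [g [gr [w Ww wg] [w' Ww' wg']] ->] : exists2 g, [/\ centrosymmetric g,
    weyl_perm C g & tilde_perm C g] & S = g @: initial n m.
  move: S aS {cS}(etrans cS (esym c0)).
  apply: (admissible_ind initial_admissible) =>
    [|g T Gg _ [g' [g'r Wg' Tg'] ->]].
    exists 1%g; last first.
      by rewrite (eq_imset (g := id)) ?imset_id // => c; rewrite perm1.
    split; first by move=> c; rewrite !perm1.
      by exists id; [exact: generated_id|exact: acts_by_id].
    by exists id; [exact: generated_id|exact: acts_by_id].
  exists (g' * g)%g.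
    split; last exact: tilde_permM Tg' (tilde_perm_generator C Gg).
      by move=> c; rewrite !permM g'r (generator_centrosymmetric Gg).
    exact: weyl_permM Wg' (weyl_perm_generator Gg).
  by rewrite -imset_comp; apply: eq_imset => c; rewrite /= permM.
split.
  exists w; first exact: weyl_hat_of_centrosymmetric wg gr.
  exact: acts_by_sum.
by exists w' => //; rewrite !res_wt; apply: acts_by_sum.
Qed.

Lemma F_tilde_SS (f : dual C 'rV[C]_n -> {set YT m n})
    (ft : dual C (subvs_of (h0 C n)) -> {set YT m n}) :
    is_colored_iso (orbit_of (@weyl_A C n) lambda) f ->
    (forall mu, orbit_of (@weyl_hat C n) lambda mu -> ft (res mu) = f mu) ->
  F_tilde lambda ft = @SS m n.
Proof.
move=> hf hft.
have c0 : #|initial n m| = m.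
  by apply: card_initial; rewrite -hk ltnW // ltnS ltn_ord.
apply/seteqP; split=> [_ [_ [w /weyl_tilde_acts_by[g gr wg] <-] <-]|Y YS].
  have aT := admissible_imset gr initial_admissible.
  have cT : #|g @: initial n m| = m by rewrite card_perm_imset.
  have -> : w (res lambda) = res (wt C (g @: initial n m)).
    rewrite fundamental_weight_wt hk -/(initial n m) !res_wt.
    exact: acts_by_sum.
  rewrite hft; last by case: (hat_orbit_admissible aT cT).
  exact/(SS_admissible hk hf cT).
have [mu Omu fmu] : exists2 mu, orbit_of (@weyl_A C n) lambda mu & f mu = Y.
  have [[_ _ fS] _ _] := hf; have [FY _] := YS.
  by have [mu Omu fmu] := fS Y FY; exists mu.
have /weyl_orbitP[S cS Emu] := Omu; rewrite hk in cS; subst mu.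
have aS : admissible S by apply/(SS_admissible hk hf cS); rewrite fmu.
have [hatS tildeS] := hat_orbit_admissible aS cS.
by exists (res (wt C S)) => //; rewrite hft.
Qed.

End Folding.

Theorem theorem9p4 (R : realType) (n m : nat) (hn : (2 <= n)%N)
  (hm1 : (1 <= m)%N) (hm2 : (2 * m <= n + 1)%N)
  (k : 'I_n) (hk : k.+1 = m)
  (f : dual R[i]%C 'rV[R[i]%C]_n -> {set YT m n})
  (hf : is_colored_iso
          (orbit_of (@weyl_A R[i]%C n) (fundamental_weight R[i]%C k)) f)
  (ft : dual R[i]%C (subvs_of (h0 R[i]%C n)) -> {set YT m n})
  (hft : forall mu,
     orbit_of (@weyl_hat R[i]%C n) (fundamental_weight R[i]%C k) mu ->
     ft (res mu) = f mu) :
  F_tilde (fundamental_weight R[i]%C k) ft = @SS m n.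
Proof. exact: (F_tilde_SS hm2 hk hf hft). Qed.
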